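(* Let $G=L_{m,r_1,\dots,r_k}$ be a $k$-handle lollipop graph, let $S=K[x_v,y_v : v\in V(G)]$ and let $r=r_1+\cdots+r_k$. Then $$\operatorname{Hilb}_{S/J_G}(t)=\frac{((m-1)t+1)(1+t)^{r-k}}{(1-t)^{m+r-k+1}}.$$ In particular, $\dim(S/J_G)=m+r-k+1$ and $e(S/J_G)=2^{r-k}m$.
   Context: $K$ is a field and $S$ is standard graded. For $m\ge2$, $K_m$ is the complete graph on $[m]$ and $P_s$ is the path on $s\geq 1$ vertices. A vertex is free in a graph if it belongs to exactly one maximal clique (for a path, the free vertices are its end vertices). $L_{m,r_1,\dots,r_k}$ denotes the graph obtained by identifying one free vertex of each of the paths $P_{r_1},\dots,P_{r_k}$ with $k$ distinct vertices of $K_m$ (the $i$-th path attached at the $i$-th chosen vertex, the paths being otherwise disjoint from each other and from $K_m$); it is called a $k$-handle lollipop graph. The binomial edge ideal of a simple graph $G$ (with totally ordered vertex set) is $J_G=(x_iy_j-x_jy_i : \{i,j\}\in E(G),\ i<j)$. $\operatorname{Hilb}_M(t)=\sum_{k\ge0}\dim_K(M_k)t^k$ is the Hilbert series, $\dim$ is Krull dimension, and $e(M)$ is the multiplicity: if $\operatorname{Hilb}_M(t)=Q(t)/(1-t)^d$ with $d=\dim M$ and $Q$ a polynomial, then $e(M)=Q(1)$. *)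

(* Defs.v *)
From HB Require Import structures.
From mathcomp Require Import all_boot all_order all_algebra.
From mathcomp Require Import boolp.
From mathcomp Require Import mpoly.

Set Implicit Arguments.
Unset Strict Implicit.
Unset Printing Implicit Defensive.

Import GRing.Theory.
Local Open Scope ring_scope.
Local Open Scope quotient_scope.

(** * Graphs: a simple graph is a symmetric irreflexive [rel] *)

Definition complete_graph (m : nat) : rel 'I_m := [rel u v | u != v].

Definition path_graph (s : nat) : rel 'I_s :=
  [rel u v : 'I_s | (u.+1 == v :> nat) || (v.+1 == u :> nat)].

Definition is_clique (V : finType) (G : rel V) (A : {set V}) : bool :=
  [forall u in A, forall v in A, (u != v) ==> G u v].

Definition free_vertex (V : finType) (G : rel V) (v : V) : Prop :=
  exists! A : {set V}, maxset (is_clique G) A /\ v \in A.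

Section Lollipop.
Variables (m k : nat) (r : 'I_k -> nat).

(* Vertices of the disjoint union of K_m and P_(r_1), ..., P_(r_k). *)
Definition pieces : finType := ('I_m + {i : 'I_k & 'I_(r i)})%type.

Definition pieces_adj : rel pieces := fun z z' =>
  match z, z' with
  | inl u, inl v => complete_graph u v
  | inr s, inr t => (tag s == tag t) && path_graph (tagged s) (tagged_as s t)
  | _, _ => false
  end.

(* Replaces the vertex [w i] of the i-th path by the vertex [a i] of K_m; the
   fibres of [glue] are the classes of vertices that get identified. *)
Definition glue (a : 'I_k -> 'I_m) (w : forall i, 'I_(r i)) (z : pieces) :
    pieces :=
  match z with
  | inr (existT i j) => if j == w i then inl (a i) else z
  | _ => z
  end.

(* [G] is the quotient of the disjoint union by the identifications of [glue],
   its vertices being labelled by [0, n[ through [pr] in an arbitrary way. *)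
Definition is_lollipop (n : nat) (G : rel 'I_n) : Prop :=
  exists (a : 'I_k -> 'I_m) (w : forall i, 'I_(r i)) (pr : pieces -> 'I_n),
  [/\ injective a,
      forall i, free_vertex (@path_graph (r i)) (w i),
      forall v, exists z, pr z = v,
      forall z z', pr z = pr z' <-> glue a w z = glue a w z'
    & forall u v, G u v <->
        exists z z', [/\ pr z = u, pr z' = v & pieces_adj z z']].

End Lollipop.

(** * Binomial edge ideals *)

Section BinomialEdgeIdeal.
Variables (K : fieldType) (n : nat).

Definition varx (v : 'I_n) : {mpoly K[n + n]} := 'X_(lshift n v).
Definition vary (v : 'I_n) : {mpoly K[n + n]} := 'X_(rshift n v).

Definition edge_binomial (i j : 'I_n) : {mpoly K[n + n]} :=
  varx i * vary j - varx j * vary i.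

Variable G : rel 'I_n.

Definition binomial_edge_ideal : pred {mpoly K[n + n]} := fun f =>
  `[< exists c : 'I_n -> 'I_n -> {mpoly K[n + n]},
      f = \sum_(i < n) \sum_(j < n | (i < j)%N && G i j)
            c i j * edge_binomial i j >].

Fact binomial_edge_idealr_closed : idealr_closed binomial_edge_ideal.
Proof.
split.
- apply/asboolP; exists (fun _ _ => 0).
  by rewrite big1 // => i _; rewrite big1 // => j _; rewrite mul0r.
- apply/negP => /asboolP [c /(congr1 (meval (fun=> 0)))].
  rewrite meval1 raddf_sum big1 => [/eqP|i _]; first by rewrite oner_eq0.
  rewrite raddf_sum big1 // => j _.
  by rewrite /= /edge_binomial /varx /vary mevalM mevalB !mevalM !mevalXU !mulr0 subr0 mulr0.
- move=> a f g /asboolP [c ->] /asboolP [c' ->]; apply/asboolP.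
  exists (fun i j => a * c i j + c' i j).
  rewrite mulr_sumr -big_split /=; apply: eq_bigr => i _.
  rewrite mulr_sumr -big_split /=; apply: eq_bigr => j _.
  by rewrite mulrDl mulrA.
Qed.

HB.instance Definition _ :=
  isIdealr.Build {mpoly K[n + n]} binomial_edge_ideal
    binomial_edge_idealr_closed.

End BinomialEdgeIdeal.

Arguments binomial_edge_ideal K [n] G.

(** * Quotients of polynomial rings as vector spaces *)

Section QuotientModule.
Variables (K : fieldType) (N : nat) (I : idealr {mpoly K[N]}).
Local Notation Q := {ideal_quot I}.

Definition quot_scale (c : K) (a : Q) : Q := \pi_Q (c%:MP) * a.

Fact quot_scaleA c d a :
  quot_scale c (quot_scale d a) = quot_scale (c * d) a.
Proof. by rewrite /quot_scale mulrA -rmorphM -mpolyCM. Qed.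

Fact quot_scale1 : left_id 1 quot_scale.
Proof. by move=> a; rewrite /quot_scale mpolyC1 rmorph1 mul1r. Qed.

Fact quot_scaleDr : right_distributive quot_scale +%R.
Proof. by move=> c a b; rewrite /quot_scale mulrDr. Qed.

Fact quot_scaleDl a : {morph quot_scale^~ a : c d / c + d}.
Proof. by move=> c d; rewrite /quot_scale mpolyCD rmorphD mulrDl. Qed.

HB.instance Definition _ := GRing.Zmodule_isLmodule.Build K Q
  quot_scaleA quot_scale1 quot_scaleDr quot_scaleDl.

End QuotientModule.

Section Dimension.
Variables (K : fieldType) (V : lmodType K) (W : V -> Prop).

Definition is_basis (h : nat) (b : 'I_h -> V) : Prop :=
  [/\ forall i, W (b i),
      forall v, W v -> exists c : 'I_h -> K, v = \sum_i c i *: b i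
    & forall c : 'I_h -> K, \sum_i c i *: b i = 0 -> forall i, c i = 0].

(* Junk value 0 if the subspace [W] is not finite-dimensional. *)
Definition dimK : nat :=
  if pselect (exists h, exists b : 'I_h -> V, is_basis b) is left e
  then projT1 (cid e) else 0.

End Dimension.

(** * Krull dimension, Hilbert series, multiplicity *)

Definition prime_chain (A : comNzRingType) (d : nat)
    (p : 'I_d.+1 -> prime_idealr A) : Prop :=
  forall i j : 'I_d.+1, (i < j)%N ->
    {subset p i <= p j} /\ ~ {subset p j <= p i}.

Definition has_krull_dim (A : comNzRingType) (d : nat) : Prop :=
  (exists p : 'I_d.+1 -> prime_idealr A, prime_chain p) /\
  (forall d' (p : 'I_d'.+1 -> prime_idealr A), prime_chain p -> (d' <= d)%N).

(* A formal power series over the integers is its sequence of coefficients. *)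
Definition mul_poly_series (p : {poly int}) (h : nat -> int) : nat -> int :=
  fun n => \sum_(i < n.+1) p`_i * h (n - i)%N.

(* h(t) = q(t) / (1 - t)^d in Z[[t]], where 1 - t is invertible. *)
Definition series_eq_frac (h : nat -> int) (q : {poly int}) (d : nat) : Prop :=
  forall n, mul_poly_series ((1 - 'X) ^+ d) h n = q`_n.

Section Hilbert.
Variables (K : fieldType) (N : nat) (I : idealr {mpoly K[N]}).

(* The degree d component of the quotient; this is a grading when I is
   homogeneous. *)
Definition homog_component (d : nat) (a : {ideal_quot I}) : Prop :=
  exists2 f : {mpoly K[N]}, f \is d.-homog & a = \pi_{ideal_quot I} f.

Definition hilbert_series : nat -> int :=
  fun d => (dimK (@homog_component d))%:Z.

Definition has_multiplicity (e : int) : Prop :=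
  exists (d : nat) (q : {poly int}),
    [/\ has_krull_dim {ideal_quot I} d, series_eq_frac hilbert_series q d
      & e = q.[1]].

End Hilbert.

(* Main.v *)
(**
For a vertex [u] of a graph [G], let [G_u] be [G] with the neighbourhood of [u]
completed to a clique, and let [rho_u] substitute 0 for [x_u] and [y_u].  As
[x_u (x_i y_j - x_j y_i)] and [y_u (x_i y_j - x_j y_i)] lie in [J_G] whenever [i]
and [j] are neighbours of [u], [f - rho_u f] lies in [J_G] for all [f] in
[J_(G_u)].  Hence [f] is in [J_G] if and only if [f] is in [J_(G_u)] and [rho_u f]
is in [J_(G - u)].  By induction on the number of vertices whose neighbourhood is
not a clique, this reduces the question whether [p] is a nonzerodivisor modulo
[J_G] to disjoint unions of complete graphs, whose ideal is the kernel of
[x_i |-> a_i s_c, y_i |-> a_i t_c], where [c] is the component of [i].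

In particular, if the neighbourhood of [v] is a clique and [w] is isolated, then
[x_v y_w - x_w y_v] is a nonzerodivisor, and adding the edge [vw] multiplies the
Hilbert series by [1 - t^2].  The same equivalence, read as
[J_G = J_(G_u) :&: rho_u^-1(J_(G - u))], gives the Hilbert series of complete graphs
by induction: one completes the neighbourhood of [v] in [K_m] with a pendant edge
at [v].  The handles are then added edge by edge.  All ideals live in the polynomial
ring on all the vertices, so that every Hilbert series is a polynomial multiple of
the Hilbert series of that ring.

If [p_0 < ... < p_d] is a chain of primes and [f_i] is in [p_(i+1)] but not in [p_i],
then the monomials in the [f_i] are linearly independent modulo [p_0]; counting
those of bounded degree bounds [d] by the order of the pole of the Hilbert series.
The bound is attained by killing variables in the prime ideal of the complete graph.
*)
Require Import Defs.
From HB Require Import structures.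
From mathcomp Require Import all_boot all_order all_algebra.
From mathcomp Require Import boolp.
From mathcomp Require Import mpoly.
From mathcomp Require Import ring zify.

Set Implicit Arguments.
Unset Strict Implicit.
Unset Printing Implicit Defensive.

Import Order.TTheory GRing.Theory Num.Theory.
Local Open Scope ring_scope.
Local Open Scope quotient_scope.

(** * Dimension of a subspace modulo another one *)

Section RelativeDimension.
Variable K : fieldType.

Definition subspace (V : lmodType K) (U : V -> Prop) : Prop :=
  U 0 /\ forall c u v, U u -> U v -> U (c *: u + v).

(* [h] is the dimension of [W / (W :&: U)]. *)
Definition reldim (V : lmodType K) (W U : V -> Prop) (h : nat) : Prop :=
  exists b : 'I_h -> V,
  [/\ forall i, W (b i),
      forall v, W v -> exists c : 'I_h -> K, U (v - \sum_i c i *: b i)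
    & forall c : 'I_h -> K, U (\sum_i c i *: b i) -> forall i, c i = 0].

Section Subspace.
Variables (V : lmodType K) (U : V -> Prop).
Hypothesis subU : subspace U.

Lemma subspace0 : U 0. Proof. by case: subU. Qed.

Lemma subspaceD u v : U u -> U v -> U (u + v).
Proof. by case: subU => _ h Uu Uv; rewrite -[u]scale1r; apply: h. Qed.

Lemma subspaceZ c u : U u -> U (c *: u).
Proof. by case: subU => U0 h Uu; rewrite -[_ *: _]addr0; apply: h. Qed.

Lemma subspaceN u : U u -> U (- u).
Proof. by rewrite -scaleN1r; apply: subspaceZ. Qed.

Lemma subspaceB u v : U u -> U v -> U (u - v).
Proof. by move=> Uu Uv; apply: subspaceD => //; apply: subspaceN. Qed.

Lemma subspace_sum (I : Type) (s : seq I) (P : pred I) (F : I -> V) :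
  (forall i, P i -> U (F i)) -> U (\sum_(i <- s | P i) F i).
Proof. by move=> UF; apply: big_ind => //; [exact: subspace0 | exact: subspaceD]. Qed.

End Subspace.

Section Uniqueness.
Variables (V : lmodType K) (U : V -> Prop).
Hypothesis subU : subspace U.

(** The coefficient matrix has more rows than columns, so its left kernel contains a nonzero
    vector. *)
Lemma dependent_family (I J : finType) (a : I -> V) (b : J -> V) :
  (#|J| < #|I|)%N ->
  (forall i, exists c : J -> K, U (a i - \sum_j c j *: b j)) ->
  exists2 u : I -> K, U (\sum_i u i *: a i) & exists i, u i != 0.
Proof.
move=> ltJI /choice [c Uc].
pose A : 'M_(#|I|, #|J|) := \matrix_(i, j) c (enum_val i) (enum_val j).
have: kermx A != 0.
  rewrite -mxrank_eq0 mxrank_ker -lt0n subn_gt0.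
  exact: leq_ltn_trans (rank_leq_col A) ltJI.
case/rowV0Pn => u /sub_kermxP uA0 /rV0Pn [i0 u0].
pose w i := u 0 (enum_rank i).
exists w; last by exists (enum_val i0); rewrite /w enum_valK.
have {}uA0 j : \sum_i w i * c i j = 0.
  move/matrixP/(_ 0 (enum_rank j)): uA0; rewrite !mxE => uA0; rewrite -[RHS]uA0.
  rewrite [RHS](reindex (@enum_rank I)) /=; last exact: onW_bij (enum_rank_bij I).
  by apply: eq_bigr => i _; rewrite /w mxE !enum_rankK.
have ->: \sum_i w i *: a i = \sum_i w i *: (a i - \sum_j c i j *: b j).
  rewrite -[LHS]subr0; under [RHS]eq_bigr => i _ do rewrite scalerBr.
  rewrite sumrB; congr (_ - _).
  under eq_bigr => i _ do rewrite scaler_sumr.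
  rewrite exchange_big /= big1 // => j _.
  by under eq_bigr => i _ do rewrite scalerA; rewrite -scaler_suml uA0 scale0r.
by apply: subspace_sum => // i _; apply: subspaceZ => //; apply: Uc.
Qed.

Lemma independent_le_spanning (I J : finType) (a : I -> V) (b : J -> V) :
  (forall c : I -> K, U (\sum_i c i *: a i) -> forall i, c i = 0) ->
  (forall i, exists c : J -> K, U (a i - \sum_j c j *: b j)) ->
  (#|I| <= #|J|)%N.
Proof.
move=> inda spanb; rewrite leqNgt; apply/negP => ltJI.
have [u Uu [i]] := dependent_family ltJI spanb.
by rewrite (inda u Uu) eqxx.
Qed.

Lemma reldim_uniq W h h' : reldim W U h -> reldim W U h' -> h = h'.
Proof.
move=> [b [Wb spanb indb]] [b' [Wb' spanb' indb']].
have := independent_le_spanning indb (fun i => spanb' _ (Wb i)).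
have := independent_le_spanning indb' (fun i => spanb _ (Wb' i)).
by rewrite !card_ord => le_h'h le_hh'; apply/eqP; rewrite eqn_leq le_hh'.
Qed.

End Uniqueness.

Definition finite_dim (V : lmodType K) (W : V -> Prop) : Prop :=
  exists (J : finType) (b : J -> V),
  forall v, W v -> exists c : J -> K, v = \sum_j c j *: b j.

Lemma finite_dim_sub (V : lmodType K) (W W' : V -> Prop) :
  (forall v, W' v -> W v) -> finite_dim W -> finite_dim W'.
Proof. by move=> sub [J [b spanb]]; exists J, b => v /sub; apply: spanb. Qed.

(** A family of [W] independent modulo [U] has at most [#|J|] members; one of maximal length spans,
    since a vector outside its span could be added. *)
Lemma reldim_exists (V : lmodType K) (W U : V -> Prop) :
  subspace U -> finite_dim W -> exists h, reldim W U h.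
Proof.
move=> subU [J [b spanb]].
pose indep h := exists a : 'I_h -> V, (forall i, W (a i)) /\
  forall c : 'I_h -> K, U (\sum_i c i *: a i) -> forall i, c i = 0.
have ex_indep : exists h, `[< indep h >].
  by exists 0%N; apply/asboolP; exists (fun=> 0); split=> [[]|c _ []] //.
have ub_indep h : `[< indep h >] -> (h <= #|J|)%N.
  case/asboolP=> a [Wa inda]; rewrite -[h]card_ord.
  apply: (independent_le_spanning (b := b) subU inda) => i.
  have [c ai] := spanb _ (Wa i).
  by exists c; rewrite -ai subrr; apply: subspace0.
have [h /asboolP [a [Wa inda]] maxh] := ex_maxnP ex_indep ub_indep.
exists h, a; split=> // v Wv; apply: contrapT => nspan.
suff: (h < h)%N by rewrite ltnn.
apply: maxh; apply/asboolP.
pose a' (i : 'I_h.+1) := oapp a v (unlift ord0 i); exists a'; split=> [i|c].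
  by rewrite /a'; case: unlift => /=.
rewrite big_ord_recl /a' unlift_none /=.
under eq_bigr => i _ do rewrite liftK /=.
move=> Uc; have c0 : c ord0 = 0.
  apply/eqP/negP => /negP c0; apply: nspan.
  exists (fun i => - ((c ord0)^-1 * c (lift ord0 i))).
  rewrite -sumrN; under eq_bigr => i _ do rewrite scaleNr opprK -scalerA.
  rewrite -scaler_sumr -[v]scale1r -(mulVf c0) -scalerA -scalerDr.
  exact: subspaceZ.
move: Uc; rewrite c0 scale0r add0r => /inda cS i.
by case: (unliftP ord0 i) => [j|] ->.
Qed.

(* Junk value 0 when no basis exists. *)
Definition rdim (V : lmodType K) (W U : V -> Prop) : nat :=
  if pselect (exists h, reldim W U h) is left e then projT1 (cid e) else 0%N.

Lemma rdimP (V : lmodType K) (W U : V -> Prop) :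
  subspace U -> finite_dim W -> reldim W U (rdim W U).
Proof.
move=> subU finW; rewrite /rdim; case: pselect => [e|[]].
  exact: projT2 (cid e).
exact: reldim_exists.
Qed.

Lemma rdim_eq (V : lmodType K) (W U : V -> Prop) h :
  subspace U -> reldim W U h -> rdim W U = h.
Proof.
move=> subU Wh; rewrite /rdim; case: pselect => [e|[]]; last by exists h.
exact: (reldim_uniq subU (projT2 (cid e)) Wh).
Qed.

(** Dimensions add along the chain [U], [U']: a basis modulo [U'] is concatenated with a basis of
    [W :&: U'] modulo [U]. *)
Lemma reldimD (V : lmodType K) (W U U' : V -> Prop) h h' :
  subspace W -> subspace U' -> (forall v, U v -> U' v) ->
  reldim W U' h -> reldim (fun v => W v /\ U' v) U h' -> reldim W U (h + h').
Proof.
move=> subW subU' sUU' [b [Wb spanb indb]] [b' [Wb' spanb' indb']].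
pose bb (i : 'I_(h + h')) := match split i with inl j => b j | inr j => b' j end.
have sumE (c : 'I_(h + h') -> K) : \sum_i c i *: bb i =
    \sum_i c (lshift h' i) *: b i + \sum_i c (rshift h i) *: b' i.
  rewrite big_split_ord /=; congr (_ + _); apply: eq_bigr => i _.
    by rewrite /bb (unsplitK (inl i)).
  by rewrite /bb (unsplitK (inr i)).
exists bb; split=> [i|v Wv|c].
- by rewrite /bb; case: split => j; [apply: Wb | case: (Wb' j)].
- have [c Uc] := spanb v Wv.
  have [|c' Uc'] := spanb' (v - \sum_i c i *: b i).
    split=> //; apply: (subspaceB subW) => //; apply: (subspace_sum subW) => i _.
    exact: (subspaceZ subW).
  exists (fun i => match split i with inl j => c j | inr j => c' j end).
  rewrite sumE opprD addrA.
  by under eq_bigr => i _ do rewrite (unsplitK (inl i));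
     under [X in _ - _ - X]eq_bigr => i _ do rewrite (unsplitK (inr i)).
rewrite sumE => Uc.
have c0 : forall i, c (lshift h' i) = 0.
  apply: indb; rewrite -[X in U' X](addrK (\sum_i c (rshift h i) *: b' i)).
  apply: (subspaceB subU'); first exact: sUU'.
  apply: (subspace_sum subU') => i _; apply: (subspaceZ subU').
  by case: (Wb' i).
have {}Uc : forall i, c (rshift h i) = 0.
  by apply: indb'; move: Uc; rewrite big1 ?add0r // => i _; rewrite c0 scale0r.
by move=> i; case: (splitP i) => j ij;
   [rewrite (_ : i = lshift h' j) | rewrite (_ : i = rshift h j)] => //;
   apply: val_inj.
Qed.

(** The hypotheses say that [f] induces an isomorphism from [W' / (W' :&: U')] onto
    [W / (W :&: U)]. *)
Lemma reldim_transfer (V V' : lmodType K) (W U : V -> Prop) (W' U' : V' -> Prop)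
    (f : V' -> V) h :
  linear f -> subspace W' -> subspace U ->
  (forall v, W' v -> W (f v)) ->
  (forall w, W w -> exists2 v, W' v & U (w - f v)) ->
  (forall v, W' v -> (U (f v) <-> U' v)) ->
  reldim W' U' h -> reldim W U h.
Proof.
move=> linf subW' subU fW onto fU [b [Wb spanb indb]].
have f0 : f 0 = 0.
  by have := linf 1 0 0; rewrite !scale1r addr0 => ff; apply: (addrI (f 0)); rewrite -ff addr0.
have sumf (c : 'I_h -> K) : \sum_i c i *: f (b i) = f (\sum_i c i *: b i).
  elim/big_rec2: _ => [|i x y _ ->]; first by rewrite f0.
  by rewrite linf.
have Wsum (c : 'I_h -> K) : W' (\sum_i c i *: b i).
  by apply: (subspace_sum subW') => i _; apply: (subspaceZ subW').
exists (f \o b); split=> [i|w Ww|c]; first exact: fW.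
  have [v W'v Uv] := onto w Ww; have [c Uc] := spanb v W'v.
  exists c; rewrite sumf -[w](subrK (f v)) -addrA.
  apply: (subspaceD subU) => //.
  have -> : f v - f (\sum_i c i *: b i) = f (v - \sum_i c i *: b i).
    by rewrite addrC -scaleN1r -linf scaleN1r addrC.
  by apply/fU => //; apply: (subspaceB subW').
by rewrite sumf => /fU; auto.
Qed.

End RelativeDimension.

(** * Hilbert functions of graded ideals *)

Section GradedIdeals.
Variables (K : fieldType) (N : nat).
Local Notation S := {mpoly K[N]}.
Implicit Types (f g p : S) (I J : S -> Prop).

Definition is_ideal I : Prop :=
  [/\ I 0, forall f g, I f -> I g -> I (f + g) & forall a f, I f -> I (a * f)].

Definition graded I : Prop := forall d f, I f -> I (pihomog mdeg d f).

Definition ideal_add I J f : Prop := exists2 g, I g & J (f - g).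

Definition ideal_add_gen I p f : Prop := exists a, I (f - a * p).

Definition nonzerodivisor I p : Prop := forall f, I (p * f) -> I f.

Lemma ideal0 I : is_ideal I -> I 0. Proof. by case. Qed.

Lemma idealD I f g : is_ideal I -> I f -> I g -> I (f + g).
Proof. by case=> _ + _; apply. Qed.

Lemma idealM I a f : is_ideal I -> I f -> I (a * f).
Proof. by case=> _ _; apply. Qed.

Lemma idealN I f : is_ideal I -> I f -> I (- f).
Proof. by move=> idI If; rewrite -mulN1r; apply: idealM. Qed.

Lemma idealB I f g : is_ideal I -> I f -> I g -> I (f - g).
Proof. by move=> idI If Ig; apply: idealD => //; apply: idealN. Qed.

Lemma ideal_subspace I : is_ideal I -> subspace I.
Proof.
move=> idI; split=> [|c u v Iu Iv]; first exact: ideal0.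
by rewrite -mul_mpolyC; apply: idealD => //; apply: idealM.
Qed.

Lemma ideal_sum I (T : Type) (s : seq T) (P : pred T) (F : T -> S) :
  is_ideal I -> (forall i, P i -> I (F i)) -> I (\sum_(i <- s | P i) F i).
Proof. by move=> idI; apply: (subspace_sum (ideal_subspace idI)). Qed.

Lemma ideal_add_ideal I J : is_ideal I -> is_ideal J -> is_ideal (ideal_add I J).
Proof.
move=> idI idJ; split.
- by exists 0; rewrite ?subrr; apply: ideal0.
- move=> f g [f1 If1 Jf] [g1 Ig1 Jg]; exists (f1 + g1); first exact: idealD.
  by rewrite opprD addrACA; apply: idealD.
by move=> a f [f1 If1 Jf]; exists (a * f1); rewrite -?mulrBr; apply: idealM.
Qed.

Lemma ideal_add_gen_ideal I p : is_ideal I -> is_ideal (ideal_add_gen I p).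
Proof.
move=> idI; split.
- by exists 0; rewrite mul0r subrr; apply: ideal0.
- move=> f g [a Ia] [b Ib]; exists (a + b).
  by rewrite mulrDl opprD addrACA; apply: idealD.
by move=> c f [a Ia]; exists (c * a); rewrite -mulrA -mulrBr; apply: idealM.
Qed.

Lemma ideal_cap_ideal I J :
  is_ideal I -> is_ideal J -> is_ideal (fun f => I f /\ J f).
Proof.
by move=> idI idJ; split=> [|f g [? ?] [? ?]|a f [? ?]];
   split; do ?[exact: ideal0 | exact: idealD | exact: idealM].
Qed.

Local Notation "d .-homogP" := (fun f : S => is_true (f \is d.-homog))
  (at level 2, format "d .-homogP").

Lemma homog_subspace d : subspace d.-homogP.
Proof. by split=> [|c u v hu hv]; [exact: rpred0 | rewrite rpredD // rpredZ]. Qed.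

Lemma homog_finite_dim d : finite_dim d.-homogP.
Proof.
exists 'X_{1..N < d.+1}, (fun m => 'X_[val m] : S) => f hf.
exists (fun m => f@_(val m)); apply: mpolywE; rewrite msizeE.
apply/bigmax_leqP_seq => m mf _; by rewrite (dhomog_mf hf mf).
Qed.

Lemma pihomogM d e p f : p \is e.-homog ->
  pihomog mdeg d (p * f) =
  if (e <= d)%N then p * pihomog mdeg (d - e) f else 0.
Proof.
move=> hp; have [k hk hdk] : exists2 k, (msize f <= k)%N & (d - e < k)%N.
  by exists (maxn (msize f) (d - e).+1); rewrite ?leq_maxl ?leq_maxr.
rewrite {1}(pihomog_partitionE hk) mulr_sumr raddf_sum /=.
have homM i : p * pihomog mdeg i f \is (e + i).-homog.
  by apply: dhomogM => //; apply: pihomogP.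
case: leqP => [le_ed|lt_de].
  have := homM (d - e)%N; rewrite (subnKC le_ed) => homd.
  rewrite (bigD1 (Ordinal hdk)) //= pihomog_dE //.
  rewrite big1 ?addr0 // => i ne; apply: pihomog_ne0 (homM i).
  by apply: contraNneq ne => eid; apply/eqP/val_inj; rewrite /= -eid addKn.
rewrite big1 // => i _; apply: pihomog_ne0 (homM i); lia.
Qed.

Lemma graded_gen I p e a :
  is_ideal I -> p \is e.-homog -> I p -> forall d, I (pihomog mdeg d (a * p)).
Proof.
move=> idI hp Ip d; rewrite mulrC (pihomogM _ _ hp).
by case: ifP => _; [rewrite mulrC; apply: idealM | apply: ideal0].
Qed.

Lemma ideal_add_gen_graded I p e :
  is_ideal I -> graded I -> p \is e.-homog -> graded (ideal_add_gen I p).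
Proof.
move=> idI grI hp d f [a Ia].
exists (if (e <= d)%N then pihomog mdeg (d - e) a else 0).
have := grI d _ Ia; rewrite raddfB /= mulrC (pihomogM _ _ hp).
by case: ifP => _; rewrite ?mul0r // mulrC.
Qed.

Definition hdim I d : nat := rdim d.-homogP I.

Lemma hdimP I d : is_ideal I -> reldim d.-homogP I (hdim I d).
Proof.
move=> /ideal_subspace subI; exact: (rdimP subI (homog_finite_dim d)).
Qed.

Lemma hdim_eq I d h : is_ideal I -> reldim d.-homogP I h -> hdim I d = h.
Proof. by move=> /ideal_subspace subI; apply: rdim_eq. Qed.

Lemma eq_hdim I J d :
  is_ideal I -> (forall f, I f <-> J f) -> hdim I d = hdim J d.
Proof.
by move=> idI eqIJ; congr (hdim _ d); apply/funext => f; apply/propext.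
Qed.

(** This is the degree [d] part of the exact sequence 0 -> S/I(-e) -> S/I -> S/(I + (p)) -> 0 whose
    first map is multiplication by [p]. *)
Lemma hdim_add_gen I p e d :
  is_ideal I -> graded I -> p \is e.-homog -> nonzerodivisor I p ->
  hdim I d =
  (hdim (ideal_add_gen I p) d + (if (e <= d)%N then hdim I (d - e) else 0))%N.
Proof.
move=> idI grI hp nzd; apply: hdim_eq => //.
have idIp := ideal_add_gen_ideal p idI.
have subI := ideal_subspace idI.
apply: reldimD (hdimP d idIp) _; [exact: homog_subspace | exact: ideal_subspace | |].
  by move=> f If; exists 0; rewrite mul0r subr0.
(* The cofactor of [p] is replaced by its component of degree [d - e]. Subtraction is truncated, so
   the last conjunct records that the cofactor vanishes when [d < e]. *)
have IpE f : f \is d.-homog -> ideal_add_gen I p f ->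
    exists2 a, I (f - a * p) & (a \is (d - e).-homog) && ((e <= d)%N || (a == 0)).
  move=> hf [a Ia].
  exists (if (e <= d)%N then pihomog mdeg (d - e) a else 0); last first.
    by case: ifP => _; rewrite ?pihomogP // rpred0 eqxx.
  have := grI d _ Ia; rewrite raddfB /= mulrC (pihomogM _ _ hp) pihomog_dE //.
  by case: ifP => _; rewrite ?mul0r // mulrC.
case: leqP => [le_ed|lt_de].
  apply: (reldim_transfer (f := fun g => p * g)) (hdimP (d - e) idI) => //.
  - by move=> c u v; rewrite mulrDr scalerAr.
  - exact: homog_subspace.
  - move=> f hf; split; first by rewrite -[X in X.-homog](subnKC le_ed) dhomogM.
    by exists f; rewrite mulrC subrr; apply: ideal0.
  - move=> f [hf /(IpE f hf) [a Ia /andP [ha _]]]; exists a => //.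
    by rewrite mulrC.
  by move=> f hf; split=> [/nzd //|]; apply: idealM.
exists (fun=> 0); split=> [[]//|f [hf /(IpE f hf) [a Ia]]|? _ []//].
rewrite leqNgt lt_de /= => /andP [_ /eqP a0]; exists (fun=> 0).
by rewrite big_ord0; move: Ia; rewrite a0 mul0r.
Qed.

(** By the isomorphism between J/(I :&: J) and (I + J)/I, the same number [h] separates [I :&: J]
    from [J] and [I] from [I + J]. *)
Lemma hdim_add_cap I J d :
  is_ideal I -> is_ideal J -> graded I -> graded J ->
  (hdim (fun f => I f /\ J f) d + hdim (ideal_add I J) d = hdim I d + hdim J d)%N.
Proof.
move=> idI idJ grI grJ.
have idIJ := ideal_add_ideal idI idJ.
have idC := ideal_cap_ideal idI idJ.
have subhom := homog_subspace d.
have subWJ : subspace (fun f => f \is d.-homog /\ J f).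
  split=> [|c u v [hu Ju] [hv Jv]]; first by split; [exact: rpred0 | exact: ideal0].
  split; first by rewrite rpredD // rpredZ.
  by have [_] := ideal_subspace idJ; apply.
have finW : finite_dim (fun f => f \is d.-homog /\ J f).
  by apply: finite_dim_sub (homog_finite_dim d) => f [].
have [h hP] := reldim_exists (ideal_subspace idC) finW.
have -> : hdim (fun f => I f /\ J f) d = (hdim J d + h)%N.
  apply: hdim_eq => //; apply: reldimD (hdimP d idJ) hP => //.
    exact: ideal_subspace.
  by move=> f [].
suff -> : hdim I d = (hdim (ideal_add I J) d + h)%N by lia.
apply: hdim_eq => //; apply: reldimD (hdimP d idIJ) _ => //.
- exact: ideal_subspace.
- by move=> f If; exists f; rewrite ?subrr //; apply: ideal0.
apply: (reldim_transfer (f := id)) hP => //; first exact: ideal_subspace.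
- by move=> f [hf Jf]; split=> //; exists 0; rewrite ?subr0 //; apply: ideal0.
- move=> f [hf [g Ig Jfg]]; exists (f - pihomog mdeg d g).
    split; first by rewrite rpredB // pihomogP.
    by rewrite -[f](pihomog_dE hf) -raddfB; apply: grJ.
  by rewrite subKr; apply: grI.
by move=> f [_ Jf]; split=> [|[]].
Qed.

End GradedIdeals.

(** * Power series with a polynomial acting on them *)

Section PowerSeries.
Implicit Types (p q : {poly int}) (h : nat -> int).
Local Notation mps := mul_poly_series.

(** A coefficient of the product only depends on a truncation of [h], so the laws below are
    inherited from polynomials. *)
Lemma mpsE p h k n : (n < k)%N -> mps p h n = (p * \poly_(i < k) h i)`_n.
Proof.
move=> lt_nk; rewrite coefM; apply: eq_bigr => i _.
by rewrite coef_poly (leq_ltn_trans (leq_subr i n)).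
Qed.

Lemma eq_mps p h h' n : (forall i, (i <= n)%N -> h i = h' i) -> mps p h n = mps p h' n.
Proof. by move=> eqh; apply: eq_bigr => i _; rewrite eqh // leq_subr. Qed.

Lemma mpsM p q h n : mps (p * q) h n = mps p (mps q h) n.
Proof.
rewrite (mpsE _ _ (ltnSn n)) -mulrA coefM; apply: eq_bigr => i _.
by rewrite [in RHS](@mpsE _ _ n.+1) // ltnS leq_subr.
Qed.

Lemma mps1 h n : mps 1 h n = h n.
Proof. by rewrite (mpsE _ _ (ltnSn n)) mul1r coef_poly ltnSn. Qed.

Lemma mpsD p q h n : mps (p + q) h n = mps p h n + mps q h n.
Proof. by rewrite !(mpsE _ _ (ltnSn n)) mulrDl coefD. Qed.

Lemma mpsN p h n : mps (- p) h n = - mps p h n.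
Proof. by rewrite !(mpsE _ _ (ltnSn n)) mulNr coefN. Qed.

Lemma mpsB p q h n : mps (p - q) h n = mps p h n - mps q h n.
Proof. by rewrite mpsD mpsN. Qed.

Lemma mpsXn e h n : mps 'X^e h n = if (e <= n)%N then h (n - e)%N else 0.
Proof.
rewrite (mpsE _ _ (ltnSn n)) coefXnM ltnNge; case: leqP => //= le_en.
by rewrite coef_poly ltnS leq_subr.
Qed.

End PowerSeries.

(** * Hilbert series as polynomial multiples of the one of the polynomial ring *)

Section HilbertSeries.
Variables (K : fieldType) (N : nat).
Local Notation S := {mpoly K[N]}.
Implicit Types (f g p : S) (I J : S -> Prop) (q : {poly int}).
Local Notation mps := mul_poly_series.

Definition poly_series (d : nat) : int := (hdim (fun f : S => f = 0) d)%:Z.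

(** By [poly_seriesP], this means that the Hilbert series of the quotient is q(t) / (1 - t)^N. *)
Definition hilb_numerator I q : Prop :=
  forall d, (hdim I d)%:Z = mps q poly_series d.

Lemma zero_ideal : is_ideal (fun f : S => f = 0).
Proof. by split=> [//|f g -> ->|a f ->]; rewrite ?addr0 ?mulr0. Qed.

Lemma hilb_numerator0 : hilb_numerator (fun f => f = 0) 1.
Proof. by move=> d; rewrite mps1. Qed.

Lemma eq_hilb_numerator I J q q' : is_ideal I -> (forall f, I f <-> J f) ->
  q = q' -> hilb_numerator I q -> hilb_numerator J q'.
Proof. by move=> idI eqIJ <- Iq d; rewrite -(eq_hdim _ idI eqIJ). Qed.

Lemma hilb_numerator_add_gen I p e q :
  is_ideal I -> graded I -> p \is e.-homog -> nonzerodivisor I p ->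
  hilb_numerator I q -> hilb_numerator (ideal_add_gen I p) ((1 - 'X^e) * q).
Proof.
move=> idI grI hp nzd Iq d.
rewrite mpsM mpsB mps1 mpsXn -!Iq (hdim_add_gen d idI grI hp nzd).
by case: ifP => _; rewrite PoszD addrK.
Qed.

Lemma hilb_numerator_cap I J q q' q'' :
  is_ideal I -> is_ideal J -> graded I -> graded J ->
  hilb_numerator (fun f => I f /\ J f) q -> hilb_numerator (ideal_add I J) q' ->
  hilb_numerator J q'' -> hilb_numerator I (q + q' - q'').
Proof.
move=> idI idJ grI grJ Cq Aq Jq d; rewrite mpsB mpsD -Cq -Aq -Jq -PoszD.
by rewrite (hdim_add_cap _ idI idJ grI grJ) PoszD addrK.
Qed.

End HilbertSeries.

(** * Killing variables *)

Section Kill.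
Variables (K : fieldType) (N : nat).
Local Notation S := {mpoly K[N]}.
Implicit Types (f g : S) (I : S -> Prop) (D E : {set 'I_N}).

Lemma mpoly_alg_ind (P : S -> Prop) :
  (forall c, P c%:MP) -> (forall i, P 'X_i) ->
  (forall f g, P f -> P g -> P (f + g)) ->
  (forall f g, P f -> P g -> P (f * g)) -> forall f, P f.
Proof.
move=> PC PX PD PM f; rewrite [f]mpolyE.
apply: big_ind => [||m _]; [by rewrite -mpolyC0 | exact: PD |].
rewrite -mul_mpolyC mpolyXE_id; apply: (PM) => //.
apply: big_ind => [||i _]; [by rewrite -mpolyC1 | exact: PM |].
by elim: (m i) => [|k IHk]; rewrite ?expr0 -?mpolyC1 // exprS; apply: PM.
Qed.

Definition kill_tuple D : N.-tuple S := [tuple if i \in D then 0 else 'X_i | i < N].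

Local Notation kill D := (comp_mpoly (kill_tuple D)).

Lemma killX D i : kill D 'X_i = if i \in D then 0 else 'X_i.
Proof. by rewrite comp_mpolyXU -tnth_nth tnth_mktuple. Qed.

Lemma killU D E f : kill D (kill E f) = kill (D :|: E) f.
Proof.
elim/mpoly_alg_ind: f => [c|i|f g IHf IHg|f g IHf IHg].
- by rewrite !comp_mpolyC.
- by rewrite !killX in_setU; case: (i \in E); rewrite ?orbT ?raddf0 // killX orbF.
- by rewrite !raddfD /= IHf IHg.
by rewrite !rmorphM /= IHf IHg.
Qed.

Lemma kill_id D f : kill D (kill D f) = kill D f.
Proof. by rewrite killU setUid. Qed.

Lemma sub_kill I D f :
  is_ideal I -> (forall i, i \in D -> I 'X_i) -> I (f - kill D f).
Proof.
move=> idI ID; elim/mpoly_alg_ind: f => [c|i|f g IHf IHg|f g IHf IHg].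
- by rewrite comp_mpolyC subrr; apply: ideal0.
- rewrite killX; case: ifP => [/ID|_]; first by rewrite subr0.
  by rewrite subrr; apply: ideal0.
- by rewrite raddfD /= opprD addrACA; apply: idealD.
rewrite rmorphM /=.
have -> : f * g - kill D f * kill D g = g * (f - kill D f) + kill D f * (g - kill D g).
  by ring.
by apply: idealD => //; apply: idealM.
Qed.

Lemma kill_ideal I D : is_ideal I -> is_ideal (fun f => I (kill D f)).
Proof.
move=> idI; split=> [|f g If Ig|a f If].
- by rewrite raddf0; apply: ideal0.
- by rewrite raddfD; apply: idealD.
by rewrite rmorphM; apply: idealM.
Qed.

(** Since [f - kill [set i] f] is a multiple of ['X_i], adding ['X_i] to an ideal stable under the
    substitution amounts to taking a preimage. *)
Lemma ideal_add_genX I i : is_ideal I -> (forall f, I f -> I (kill [set i] f)) ->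
  forall f, ideal_add_gen I 'X_i f <-> I (kill [set i] f).
Proof.
move=> idI killI f; split=> [[a /killI]|If].
  by rewrite raddfB /= rmorphM /= killX set11 mulr0 subr0.
have [||a fE] := @sub_kill (fun g => exists a, g = a * 'X_i) [set i] f.
- split=> [|g h [a ->] [b ->]|b g [a ->]]; first by exists 0; rewrite mul0r.
    by exists (a + b); rewrite mulrDl.
  by exists (b * a); rewrite mulrA.
- by move=> j /set1P ->; exists 1; rewrite mul1r.
by exists a; rewrite -fE subKr.
Qed.

Lemma hilb_numerator_kill1 I i q :
  is_ideal I -> graded I -> (forall f, I f -> I (kill [set i] f)) ->
  nonzerodivisor I 'X_i -> hilb_numerator I q ->
  graded (fun f => I (kill [set i] f)) /\
  hilb_numerator (fun f => I (kill [set i] f)) ((1 - 'X) * q).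
Proof.
move=> idI grI killI nzd Iq; have IE := ideal_add_genX idI killI.
have hX : ('X_i : S) \is 1.-homog by rewrite dhomogX /= mdeg1.
split=> [d f /IE /(ideal_add_gen_graded idI grI hX)|]; first by move=> h; apply/IE.
apply: eq_hilb_numerator IE _ _; first exact: ideal_add_gen_ideal.
  by rewrite -[X in 1 - X]expr1.
exact: hilb_numerator_add_gen.
Qed.

Lemma killT f : kill setT f = (f@_0%MM)%:MP.
Proof.
rewrite [in LHS](mpolyE f) raddf_sum /=.
have [m0|m0] := boolP (0%MM \in msupp f); last first.
  rewrite (memN_msupp_eq0 m0) mpolyC0 big_seq big1 // => m mf.
  have [i mi] : exists i, m i != 0%N.
    apply/existsP; apply: contraNT m0; rewrite negb_exists => /forallP m0.
    suff -> : 0%MM = m by []; apply/mnmP => i; rewrite mnm0E.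
    by have:= m0 i; rewrite negbK => /eqP.
  rewrite linearZ /= comp_mpolyX (bigD1 i) //= tnth_mktuple inE.
  by rewrite expr0n (negPf mi) mul0r scaler0.
rewrite (bigD1_seq _ m0) ?msupp_uniq //= linearZ /= mpolyX0 rmorph1.
rewrite big1 ?addr0 => [|m ne]; first by rewrite -mul_mpolyC mulr1.
have [i mi] : exists i, m i != 0%N.
  apply/existsP; apply: contraNT ne; rewrite negb_exists => /forallP m0'.
  apply/eqP/mnmP => i; rewrite mnm0E.
  by have:= m0' i; rewrite negbK => /eqP.
rewrite linearZ /= comp_mpolyX (bigD1 i) //= tnth_mktuple inE.
by rewrite expr0n (negPf mi) mul0r scaler0.
Qed.

(* The variables form a regular sequence, whose quotient ring is [K]. *)
Lemma poly_seriesP d :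
  mul_poly_series ((1 - 'X) ^+ N) (poly_series K N) d = (d == 0%N)%:R.
Proof.
pose D k := [set i : 'I_N | (i < k)%N].
pose I k := fun f => kill (D k) f = 0.
have idI k : is_ideal (I k) := kill_ideal (D k) (@zero_ideal K N).
have numI k : (k <= N)%N -> graded (I k) /\ hilb_numerator (I k) ((1 - 'X) ^+ k).
  elim: k => [_|k IHk lt_kN].
    have I0 f : f = 0 <-> I 0%N f.
      have -> : I 0%N f = (kill set0 f = 0).
        by congr (kill _ f = 0); apply/setP => i; rewrite !inE.
      have -> // : kill set0 f = f.
      elim/mpoly_alg_ind: f => [c|i|f g IHf IHg|f g IHf IHg].
      - by rewrite comp_mpolyC.
      - by rewrite killX inE.
      - by rewrite raddfD /= IHf IHg.
      by rewrite rmorphM /= IHf IHg.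
    split=> [e f /(I0 f) ->|]; first by rewrite raddf0; apply: ideal0.
    exact: eq_hilb_numerator (@zero_ideal K N) I0 (esym (expr0 _))
      (@hilb_numerator0 K N).
  have [grI Iq] := IHk (ltnW lt_kN); pose i := Ordinal lt_kN.
  have IS f : I k (kill [set i] f) <-> I k.+1 f.
    rewrite /I killU; suff -> : D k :|: [set i] = D k.+1 by split.
    apply/setP => j; rewrite !inE ltnS [in RHS]leq_eqVlt orbC; congr (_ || _); exact: val_eqE.
  have [|f|grS Sq] := @hilb_numerator_kill1 _ i _ (idI k) grI _ _ Iq.
  - move=> f; rewrite /I killU setUC -killU => ->; exact: raddf0.
  - rewrite /I rmorphM /= killX inE ltnn => /eqP.
    by rewrite mulf_eq0 -msize_poly_eq0 mmeasureX /= => /eqP.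
  split=> [e f /IS h|]; first by apply/IS; apply: grS.
  by apply: eq_hilb_numerator IS _ Sq; [exact: kill_ideal | rewrite -exprS].
have [_ /(_ d) <-] := numI N (leqnn N).
have IE f : I N f <-> f@_0%MM = 0.
  rewrite /I (_ : D N = setT); last first.
    by apply/setP => i; rewrite !inE ltn_ord.
  by rewrite killT; split=> [/eqP|->//]; rewrite mpolyC_eq0 => /eqP.
suff -> : hdim (I N) d = (d == 0%N) by case: eqP.
apply: hdim_eq => //; case: eqP => [->|/eqP d0] /=.
  exists (fun=> 1); split=> [_|f hf|c /IE]; first exact: dhomog1.
    exists (fun=> f@_0%MM); apply/IE.
    by rewrite big_ord1 mcoeffB mcoeffZ mcoeff1 eqxx mulr1 subrr.
  by rewrite big_ord1 mcoeffZ mcoeff1 eqxx mulr1 => c0 i; rewrite ord1.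
exists (fun=> 0); split=> [[]//|f hf|? _ []//]; exists (fun=> 0); apply/IE.
by rewrite big_ord0 subr0 (dhomog_nemf_coeff hf) //= mdeg0 eq_sym.
Qed.

End Kill.

Notation kill D := (comp_mpoly (kill_tuple _ D)).

(** * Binomial edge ideals of disjoint unions of complete graphs *)

Lemma leq_sum_eq (T : finType) (P : pred T) (F F' : T -> nat) :
  (forall j, P j -> F j <= F' j)%N ->
  (\sum_(j | P j) F j = \sum_(j | P j) F' j)%N -> forall j, P j -> F j = F' j.
Proof.
move=> leF /eqP.
have [_ ->] := leqif_sum (fun j Pj => leqif_eq (leF j Pj)).
by move=> /forall_inP eqF j /eqF /eqP.
Qed.

Section EdgeIdeals.
Variables (K : fieldType) (n : nat).
Local Notation S := {mpoly K[n + n]}.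
Local Notation x := (@varx K n).
Local Notation y := (@vary K n).
Local Notation eb := (@edge_binomial K n).
Implicit Types (G H : rel 'I_n) (f g : S) (I : S -> Prop) (u v w : 'I_n).

Definition edge_ideal G f : Prop := f \in binomial_edge_ideal K G.

Lemma edge_ideal_ideal G : is_ideal (edge_ideal G).
Proof.
by split=> [|f g|a f]; [exact: rpred0 | exact: rpredD | exact: idealMr].
Qed.

Lemma edge_binomialC i j : eb i j = - eb j i.
Proof. by rewrite /edge_binomial; ring. Qed.

Lemma edge_binomialii i : eb i i = 0.
Proof. exact: subrr. Qed.

Lemma edge_idealP G I f : is_ideal I -> (forall i j, G i j -> I (eb i j)) ->
  edge_ideal G f -> I f.
Proof.
move=> idI IG /asboolP [c ->].
apply: ideal_sum => // i _; apply: ideal_sum => // j /andP [_ Gij].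
by apply: idealM => //; apply: IG.
Qed.

Lemma edge_ideal_gen G i j : ssrbool.symmetric G -> G i j -> edge_ideal G (eb i j).
Proof.
move=> symG.
have lt_case u v : (u < v)%N -> G u v -> edge_ideal G (eb u v).
  move=> lt_uv Guv; apply/asboolP.
  exists (fun k l => ((k == u) && (l == v))%:R).
  rewrite (bigD1 u) //= (bigD1 v) /=; last by rewrite lt_uv.
  rewrite !eqxx mul1r big1 ?addr0 => [|l /andP [_ /negPf ->]]; last first.
    by rewrite andbF mul0r.
  rewrite big1 ?addr0 // => k /negPf ku.
  by rewrite big1 // => l _; rewrite ku mul0r.
case: (ltngtP i j) => [|lt_ji Gij|/val_inj ->]; first exact: lt_case.
  rewrite edge_binomialC; apply: idealN (edge_ideal_ideal G) _.
  by apply: lt_case; rewrite // symG.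
by rewrite edge_binomialii => _; apply: ideal0; apply: edge_ideal_ideal.
Qed.

Lemma edge_binomial_homog i j : eb i j \is 2.-homog.
Proof.
by apply: rpredB; rewrite -mpolyXD dhomogX /= mdegD !mdeg1.
Qed.

Lemma edge_idealS G H : ssrbool.symmetric H -> subrel G H ->
  forall f, edge_ideal G f -> edge_ideal H f.
Proof.
move=> symH subGH f; apply: edge_idealP => [|i j /subGH]; first exact: edge_ideal_ideal.
exact: edge_ideal_gen.
Qed.

Lemma eq_edge_ideal G H : G =2 H -> edge_ideal G = edge_ideal H.
Proof.
move=> eqGH; suff -> : G = H by [].
by apply/funext => i; apply/funext => j; apply: eqGH.
Qed.

(** The polynomials all of whose homogeneous components lie in the edge ideal form an ideal, which
    contains the edge binomials as these are homogeneous. *)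
Lemma edge_ideal_graded G : ssrbool.symmetric G -> graded (edge_ideal G).
Proof.
move=> symG d f Jf; have idJ := edge_ideal_ideal G.
move: d; apply: (@edge_idealP _ (fun f => forall d, edge_ideal G (pihomog mdeg d f)) _ _ _ Jf)
  => [|i j Gij e]; last first.
  rewrite -[eb i j]mul1r; apply: graded_gen e => //.
    exact: edge_binomial_homog.
  exact: edge_ideal_gen.
split=> [e|f1 g1 Jf1 Jg1 e|a f1 Jf1 e].
- by rewrite raddf0; apply: ideal0.
- by rewrite raddfD; apply: (idealD idJ (Jf1 e) (Jg1 e)).
rewrite [f1](pihomog_partitionE (leqnn (msize f1))) mulr_sumr raddf_sum.
apply: (ideal_sum _ idJ) => i _.
exact: (graded_gen _ idJ (pihomogP _ _ _) (Jf1 i)).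
Qed.

Section Cliques.
Variable c : 'I_n -> 'I_n.

Definition cliques : rel 'I_n := [rel i j | (i != j) && (c i == c j)].

Lemma cliques_sym : ssrbool.symmetric cliques.
Proof. by move=> i j; rewrite /cliques /= (eq_sym i) (eq_sym (c i)). Qed.

Lemma cliques_gen i j : c i = c j -> edge_ideal cliques (eb i j).
Proof.
move=> cij; have [->|ij] := eqVneq i j.
  by rewrite edge_binomialii; apply: ideal0; apply: edge_ideal_ideal.
by apply: edge_ideal_gen; [exact: cliques_sym | rewrite /cliques /= ij cij eqxx].
Qed.

(* The target of [param] has variables [a_i], [s_k], [t_k], and [param] maps
   [x_i] to [a_i s_(c i)] and [y_i] to [a_i t_(c i)]. *)
Local Notation T := {mpoly K[n + n + n]}.
Definition va i : 'I_(n + n + n) := lshift n (lshift n i).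
Definition vs i : 'I_(n + n + n) := lshift n (rshift n i).
Definition vt i : 'I_(n + n + n) := rshift (n + n) i.

(** Exponents are recorded because [param] maps monomials to monomials: its kernel is then governed
    by pairs of monomials with the same image. *)
Definition param_exp1 (k : 'I_(n + n)) : 'X_{1..n + n + n} :=
  match split k with
  | inl i => (U_(va i) + U_(vs (c i)))%MM
  | inr i => (U_(va i) + U_(vt (c i)))%MM
  end.

Definition param_exp (m : 'X_{1..n + n}) : 'X_{1..n + n + n} :=
  (\sum_k param_exp1 k *+ m k)%MM.

Definition param : S -> T :=
  comp_mpoly [tuple 'X_[param_exp1 k] | k < n + n].

Lemma param_X m : param 'X_[m] = 'X_[param_exp m].
Proof.
rewrite /param comp_mpolyX /param_exp -mprodXnE; apply: eq_bigr => k _.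
by rewrite tnth_mktuple.
Qed.

Lemma paramE f : param f = \sum_(m <- msupp f) f@_m *: 'X_[param_exp m].
Proof.
rewrite /param comp_mpolyEX; apply: eq_bigr => m _.
by rewrite -param_X /param comp_mpolyX.
Qed.

HB.instance Definition _ := GRing.RMorphism.copy param
  (comp_mpoly [tuple 'X_[K, param_exp1 k] | k < n + n]).

Lemma param_x i : param (x i) = 'X_(va i) * 'X_(vs (c i)).
Proof.
by rewrite /param /varx comp_mpolyXU -tnth_nth tnth_mktuple /param_exp1
  (unsplitK (inl i)) mpolyXD.
Qed.

Lemma param_y i : param (y i) = 'X_(va i) * 'X_(vt (c i)).
Proof.
by rewrite /param /vary comp_mpolyXU -tnth_nth tnth_mktuple /param_exp1
  (unsplitK (inr i)) mpolyXD.
Qed.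

Lemma param_exp_va m i :
  param_exp m (va i) = (m (lshift n i) + m (rshift n i))%N.
Proof.
rewrite mnm_sumE big_split_ord /= (bigD1 i) //= big1 => [|j ji].
  rewrite (bigD1 i) //= big1 => [|j ji].
    rewrite !mulmnE /param_exp1 (unsplitK (inl i)) (unsplitK (inr i)) !mnmDE !mnm1E.
    by rewrite !eqxx !eq_shift !mul1n !addn0.
  rewrite mulmnE /param_exp1 (unsplitK (inr j)) mnmDE !mnm1E !eq_shift.
  by rewrite (negPf ji).
rewrite mulmnE /param_exp1 (unsplitK (inl j)) mnmDE !mnm1E !eq_shift.
by rewrite (negPf ji).
Qed.

Lemma param_exp_vt m k :
  param_exp m (vt k) = (\sum_(i | c i == k) m (rshift n i))%N.
Proof.
rewrite mnm_sumE big_split_ord /= big1 => [|j _].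
  rewrite add0n [RHS]big_mkcond; apply: eq_bigr => i _.
  rewrite mulmnE /param_exp1 (unsplitK (inr i)) mnmDE !mnm1E !eq_shift /= add0n.
  by case: eqP; rewrite ?mul1n.
by rewrite mulmnE /param_exp1 (unsplitK (inl j)) mnmDE !mnm1E !eq_shift.
Qed.

(* Replacing [x_j y_i] by [x_i y_j] inside a clique brings the [y]-exponents of
   [m] closer to those of [m']. *)
Lemma param_exp_congr m m' : param_exp m = param_exp m' ->
  edge_ideal cliques ('X_[m] - 'X_[m']).
Proof.
have idJ := edge_ideal_ideal cliques.
(* Truncated subtraction keeps only the excess of the [y]-exponents over those of [m']; this is the
   induction measure. *)
pose dist m1 := (\sum_i (m1 (rshift n i) - m' (rshift n i)))%N.
have [k] := ubnP (dist m); elim: k m => // k IHk m; rewrite ltnS => dk eqm.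
have eqa i : (m (lshift n i) + m (rshift n i) = m' (lshift n i) + m' (rshift n i))%N.
  by rewrite -!param_exp_va eqm.
have eqt i : (\sum_(j | c j == i) m (rshift n j) = \sum_(j | c j == i) m' (rshift n j))%N.
  by rewrite -!param_exp_vt eqm.
have [/forallP le_y|] := boolP [forall i, m (rshift n i) <= m' (rshift n i)]%N.
  have eqy i : m (rshift n i) = m' (rshift n i).
    by apply: (leq_sum_eq _ (eqt (c i))).
  suff -> : m = m' by rewrite subrr; apply: ideal0.
  apply/mnmP => i; case: (splitP i) => j ij.
    have -> : i = lshift n j by apply: val_inj.
    by have := eqa j; rewrite eqy => /addIn.
  by have -> : i = rshift n j by apply: val_inj.
rewrite negb_forall => /existsP [i]; rewrite -ltnNge => lt_i.
(* The [y]-degrees of each clique agree, so an excess at [i] is compensated by a deficit at some [j]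
   of the same clique. As the total degree at [j] agrees too, [x_j] divides [m]. *)
have [j cji lt_j] : exists2 j, c j == c i & (m (rshift n j) < m' (rshift n j))%N.
  apply/exists_inP; apply: contraTT lt_i; rewrite negb_exists_in => /forall_inP ge_y.
  have {}ge_y j : c j == c i -> (m' (rshift n j) <= m (rshift n j))%N.
    by move=> /ge_y; rewrite -leqNgt.
  by rewrite (leq_sum_eq ge_y (esym (eqt (c i)))) ?ltnn.
have ij : i != j by apply: contraTneq lt_j => <-; rewrite -leqNgt ltnW.
have mi0 : m (rshift n i) != 0%N by lia.
have mj0 : m (lshift n j) != 0%N by have := eqa j; lia.
pose m0 := (m - (U_(lshift n j) + U_(rshift n i)))%MM.
have m0E : m = (m0 + (U_(lshift n j) + U_(rshift n i)))%MM.
  rewrite submK //; apply/mnm_lepP => k'; rewrite mnmDE !mnm1E.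
  have [<-|_] := eqVneq (lshift n j) k'; first by rewrite eq_shift /= addn0 lt0n.
  by have [<-|_] := eqVneq (rshift n i) k'; rewrite ?lt0n.
pose m1 := (m0 + (U_(lshift n i) + U_(rshift n j)))%MM.
have -> : 'X_[m] - 'X_[m'] = 'X_[m0] * eb j i + ('X_[m1] - 'X_[m']).
  rewrite {1}m0E /m1 !mpolyXD /edge_binomial /varx /vary; ring.
apply: idealD => //; first by apply: idealM => //; apply: cliques_gen; apply/eqP.
have m1y l : m1 (rshift n l) = (m (rshift n l) + (l == j) - (l == i))%N.
  rewrite [in RHS]m0E /m1 !mnmDE !mnm1E !eq_shift ![in RHS](eq_sym l).
  by have [<-|] := eqVneq i l; have [|] := eqVneq j l => //=; lia.
apply: IHk.
  apply: leq_trans dk; rewrite /dist [X in (_ < X)%N](bigD1 i) //= (bigD1 i) //=.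
  rewrite -addSn leq_add //.
    by rewrite m1y (negPf ij) eqxx; lia.
  apply: leq_sum => l li; rewrite m1y (negPf li).
  by have [->|] := eqVneq l j; rewrite ?subn0 ?addn0 //; lia.
rewrite -eqm m0E /m1 /param_exp; apply/mnmP => l.
have add a b : param_exp (a + b)%MM = (param_exp a + param_exp b)%MM.
  apply/mnmP => l'; rewrite mnmDE !mnm_sumE -big_split; apply: eq_bigr => k' _ /=.
  by rewrite !mulmnE mnmDE mulnDr.
have one k' : param_exp U_(k')%MM = param_exp1 k'.
  apply/mnmP => l'; rewrite mnm_sumE (bigD1 k') //= big1 => [|k'' ne].
    by rewrite mulmnE mnm1E eqxx muln1 addn0.
  by rewrite mulmnE mnm1E eq_sym (negPf ne) muln0.
rewrite -!/(param_exp _) !add !one /param_exp1.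
rewrite (unsplitK (inl i)) (unsplitK (inl j)) (unsplitK (inr i)) (unsplitK (inr j)).
by rewrite (eqP cji) !mnmDE; lia.
Qed.

Lemma param_cliques f : edge_ideal cliques f -> param f = 0.
Proof.
apply: (edge_idealP (I := fun f => param f = 0)) => [|i j /andP [_ /eqP cij]].
  split=> [|f1 g1 f0 g0|a f1 f0]; first exact: raddf0.
    by rewrite raddfD /= f0 g0 addr0.
  by rewrite rmorphM /= f0 mulr0.
rewrite /edge_binomial raddfB /= !rmorphM /= !param_x !param_y cij; ring.
Qed.

(** A monomial of [f] must cancel in the image against another one with the same image. Subtracting
    a multiple of their difference, which lies in the ideal, shortens the support. *)
Lemma param_ker f : param f = 0 -> edge_ideal cliques f.
Proof.
have idJ := edge_ideal_ideal cliques.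
have [k] := ubnP (size (msupp f)); elim: k f => // k IHk f; rewrite ltnS => szf f0.
case supp_f: (msupp f) => [|m s].
  by rewrite (msuppnil0 supp_f); apply: ideal0.
have mf : m \in msupp f by rewrite supp_f mem_head.
have [m1 [m1f m1m eqm]] : exists m1 : 'X_{1..n + n},
    [/\ m1 \in msupp f, m1 != m & param_exp m1 = param_exp m].
  apply: contrapT => nex; move: (mf); rewrite mcoeff_msupp => /eqP; apply.
  have /(congr1 (mcoeff (param_exp m))) := f0.
  rewrite paramE mcoeff0 raddf_sum /= (bigD1_seq m) ?msupp_uniq //=.
  rewrite mcoeffZ mcoeffX eqxx mulr1.
  rewrite big_seq_cond big1 ?addr0 // => m1 /andP [m1f m1m].
  rewrite mcoeffZ mcoeffX; case: eqP => [eqm|_]; last by rewrite mulr0.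
  by case: nex; exists m1.
pose g : S := f - f@_m *: ('X_[m] - 'X_[m1]).
have -> : f = (f@_m)%:MP * ('X_[m] - 'X_[m1]) + g by rewrite /g mul_mpolyC addrC subrK.
apply: idealD => //; first by apply: idealM => //; apply: param_exp_congr.
apply: IHk; last first.
  by rewrite /g -mul_mpolyC rmorphB /= f0 rmorphM rmorphB /= !param_X eqm subrr mulr0 subr0.
apply: leq_trans szf; rewrite supp_f /= ltnS.
apply: uniq_leq_size (msupp_uniq _) _ => m2.
rewrite mcoeff_msupp mcoeffB mcoeffZ mcoeffB !mcoeffX.
have [<-|m2m] := eqVneq m m2; first by rewrite (negPf m1m) subr0 mulr1 subrr eqxx.
rewrite sub0r; have [<- _|_] := eqVneq m1 m2.
  by move: m1f; rewrite supp_f inE (negPf m1m).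
by rewrite oppr0 mulr0 subr0 -mcoeff_msupp supp_f inE eq_sym (negPf m2m).
Qed.

End Cliques.
End EdgeIdeals.

(** * Completing the neighbourhood of a vertex *)

Section Ohtani.
Variables (K : fieldType) (n : nat).
Local Notation S := {mpoly K[n + n]}.
Local Notation x := (@varx K n).
Local Notation y := (@vary K n).
Local Notation eb := (@edge_binomial K n).
Local Notation J := (@edge_ideal K n).
Implicit Types (G H : rel 'I_n) (f g p : S) (u v w i j : 'I_n) (q : {poly int}).

Definition graph G : Prop := ssrbool.symmetric G /\ irreflexive G.

Definition complete_at G u : rel 'I_n :=
  [rel i j | G i j || [&& i != j, G u i & G u j]].

Definition del_vertex G u : rel 'I_n := [rel i j | [&& i != u, j != u & G i j]].

Definition simplicial G v : bool :=
  [forall i, forall j, [&& G v i, G v j & i != j] ==> G i j].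

Definition xy u : {set 'I_(n + n)} := [set lshift n u; rshift n u].

Lemma simplicialP G v :
  reflect (forall i j, G v i -> G v j -> i != j -> G i j) (simplicial G v).
Proof.
apply: (iffP forallP) => [h i j Gi Gj ij|h i].
  by have /forallP /(_ j) := h i; rewrite Gi Gj ij.
by apply/forallP => j; apply/implyP => /and3P [Gi Gj ij]; apply: h.
Qed.

Lemma complete_at_graph G u : graph G -> graph (complete_at G u).
Proof.
case=> symG irrG; split=> [i j|i]; rewrite /complete_at /=.
  by rewrite symG (eq_sym i) [G u i && _]andbC.
by rewrite irrG eqxx.
Qed.

Lemma del_vertex_graph G u : graph G -> graph (del_vertex G u).
Proof.
case=> symG irrG; split=> [i j|i]; rewrite /del_vertex /=.
  by rewrite symG andbCA.
by rewrite irrG !andbF.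
Qed.

(** With [del_vertex_simplicial], this makes the number of non-simplicial vertices drop in both
    graphs of [ohtani] when [u] is not simplicial. *)
Lemma complete_at_simplicial G u v : graph G ->
  simplicial G v || (v == u) -> simplicial (complete_at G u) v.
Proof.
case=> symG irrG /orP [/simplicialP sv|/eqP ->]; apply/simplicialP => i j;
  rewrite /complete_at /=; last first.
  by rewrite irrG /= !andbF !orbF => -> -> ->; rewrite orbT.
move=> /orP [vi|/and3P [vi uv ui]] /orP [vj|/and3P [vj uv' uj]] ij.
- by rewrite sv.
- have [iu|iu] := eqVneq i u; first by rewrite iu uj.
  by rewrite ij uj (symG u) (sv i u) ?orbT // symG.
- have [ju|ju] := eqVneq j u; first by rewrite ju symG ui.
  by rewrite ij ui (symG u) (sv j u) ?orbT // symG.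
by rewrite ij ui uj orbT.
Qed.

Lemma del_vertex_simplicial G u v :
  simplicial G v || (v == u) -> simplicial (del_vertex G u) v.
Proof.
case/orP => [/simplicialP sv|/eqP ->]; apply/simplicialP => i j;
  rewrite /del_vertex /=; last by rewrite eqxx.
by move=> /and3P [_ iu vi] /and3P [_ ju vj] ij; rewrite iu ju sv.
Qed.

Lemma killx D u : kill D (x u) = if lshift n u \in D then 0 else x u.
Proof. exact: killX. Qed.

Lemma killy D u : kill D (y u) = if rshift n u \in D then 0 else y u.
Proof. exact: killX. Qed.

Lemma kill_edge_binomial u i j :
  kill (xy u) (eb i j) = if (i == u) || (j == u) then 0 else eb i j.
Proof.
rewrite /edge_binomial raddfB /= !rmorphM /= !killx !killy !inE !eq_shift !orbF /=.
by case: (i == u); case: (j == u); rewrite /= ?(mulr0, mul0r, subrr).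
Qed.

Lemma kill_edge_ideal G u f : graph G -> J G f -> J (del_vertex G u) (kill (xy u) f).
Proof.
move=> grG; have idJ := kill_ideal (xy u) (edge_ideal_ideal K (del_vertex G u)).
apply: (edge_idealP idJ) => i j Gij; rewrite kill_edge_binomial.
case: ifP => [_|/norP [iu ju]]; first exact: ideal0 (edge_ideal_ideal _ _).
apply: edge_ideal_gen; first by case: (del_vertex_graph u grG).
by rewrite /del_vertex /= iu ju.
Qed.

(* For neighbours [i] and [j] of [u], both [x_u] and [y_u] multiply the binomial
   of [{i, j}] into the ideal of [G]. *)
Lemma sub_kill_edge_ideal G u f : graph G ->
  J (complete_at G u) f -> J G (f - kill (xy u) f).
Proof.
move=> grG; have [symG irrG] := grG; have idJ := edge_ideal_ideal K G.
(* The memberships of [x u * f] and [y u * f] make [I] stable under products: [a - kill (xy u) a]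
   lies in the ideal of [x u] and [y u]. *)
pose I f := [/\ J G (x u * f), J G (y u * f) & J G (f - kill (xy u) f)].
suff: J (complete_at G u) f -> I f by move=> h /h [].
apply: edge_idealP => [|i j].
  split=> [|f1 g1 [xf yf kf] [xg yg kg]|a f1 [xf yf kf]]; rewrite /I.
  - by rewrite raddf0 !mulr0 subrr; split; apply: ideal0.
  - by rewrite raddfD /= !mulrDr opprD addrACA; split; apply: idealD.
  rewrite !(mulrCA _ a) rmorphM /=; split; do ?[exact: idealM].
  have -> : a * f1 - kill (xy u) a * kill (xy u) f1 =
      (a - kill (xy u) a) * f1 + kill (xy u) a * (f1 - kill (xy u) f1) by ring.
  apply: idealD => //; last exact: idealM.
  apply: (@sub_kill _ _ (fun a => J G (a * f1))) => [|i].
    split=> [|b c Jb Jc|b c Jc]; first by rewrite mul0r; apply: ideal0.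
      by rewrite mulrDl; apply: idealD.
    by rewrite -mulrA; apply: idealM.
  by rewrite !inE => /orP [] /eqP ->.
rewrite /I kill_edge_binomial => /orP [Gij|/and3P [ij ui uj]].
  have Jij : J G (eb i j) by apply: edge_ideal_gen.
  split; do ?[exact: idealM]; case: ifP => _; rewrite ?subr0 // subrr.
  exact: ideal0.
have /negPf -> : i != u by apply: contraTneq ui => ->; rewrite irrG.
have /negPf -> : j != u by apply: contraTneq uj => ->; rewrite irrG.
have Ji : J G (eb u i) by apply: edge_ideal_gen.
have Jj : J G (eb u j) by apply: edge_ideal_gen.
split; last by rewrite subrr; apply: ideal0.
  (* This expands a 3 x 3 determinant with a repeated row along that row. *)
  have -> : x u * eb i j = x i * eb u j - x j * eb u i.
    by rewrite /edge_binomial; ring.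
  by apply: idealB => //; apply: idealM.
have -> : y u * eb i j = y i * eb u j - y j * eb u i.
  by rewrite /edge_binomial; ring.
by apply: idealB => //; apply: idealM.
Qed.

Lemma edge_ideal_complete G u f : graph G -> J G f -> J (complete_at G u) f.
Proof.
move=> /(complete_at_graph u) [symG' _]; apply: edge_idealS => //.
by move=> i j Gij; rewrite /complete_at /= Gij.
Qed.

Lemma edge_ideal_del G u f : graph G -> J (del_vertex G u) f -> J G f.
Proof.
by move=> [symG _]; apply: edge_idealS => // i j /and3P [].
Qed.

Lemma ohtani G u f : graph G ->
  J G f <-> J (complete_at G u) f /\ J (del_vertex G u) (kill (xy u) f).
Proof.
move=> grG; split=> [Jf|[Jcf Jdf]].
  by split; [exact: edge_ideal_complete | exact: kill_edge_ideal].
rewrite -[f](subrK (kill (xy u) f)); apply: idealD; first exact: edge_ideal_ideal.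
  exact: sub_kill_edge_ideal.
exact: edge_ideal_del Jdf.
Qed.

(** This computes the sum of the two ideals whose intersection appears in [ohtani]. In one direction
    [f] splits as [kill (xy u) f] plus a polynomial that the substitution annihilates. *)
Lemma ohtani_add G u f : graph G ->
  ideal_add (J (complete_at G u)) (fun g => J (del_vertex G u) (kill (xy u) g)) f <->
  J (del_vertex (complete_at G u) u) (kill (xy u) f).
Proof.
move=> grG; have grG' := complete_at_graph u grG.
have idd := edge_ideal_ideal K (del_vertex (complete_at G u) u).
split=> [[g Jg Jfg]|Jf].
  rewrite -[f](subrK g) raddfD /=; apply: idealD => //; last exact: kill_edge_ideal.
  move: Jfg; apply: edge_idealS; first by case: (del_vertex_graph u grG').
  by move=> i j; rewrite /del_vertex /complete_at /= => /and3P [-> -> ->].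
exists (kill (xy u) f); first exact: edge_ideal_del Jf.
by rewrite raddfB /= kill_id subrr; apply: ideal0; apply: edge_ideal_ideal.
Qed.

(** * Nonzerodivisors modulo binomial edge ideals *)

(** When all neighbourhoods are cliques, being equal or adjacent is an equivalence relation, and [c]
    picks a representative of each class. *)
Lemma simplicial_cliques G : graph G -> (forall v, simplicial G v) ->
  exists c : 'I_n -> 'I_n, G =2 cliques c.
Proof.
move=> [symG irrG] simG.
pose R i j := (i == j) || G i j.
have Rsym i j : R i j = R j i by rewrite /R eq_sym symG.
have Rtr i j k : R i j -> R j k -> R i k.
  rewrite /R => /orP [/eqP -> //|ij] /orP [/eqP <-|jk]; first by rewrite ij orbT.
  have [//|ik /=] := eqVneq i k.
  by apply: (simplicialP _ _ (simG j)) => //; rewrite symG.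
(* The pick depends only on the class of [i], and it always succeeds because [R i i] holds. *)
pose c i := odflt i [pick j | R i j].
have Rc i : R i (c i).
  by rewrite /c; case: pickP => //= _; rewrite /R eqxx.
exists c => i j; rewrite /cliques /=.
have [->|ij /=] := eqVneq i j; first by rewrite irrG.
have -> : G i j = R i j by rewrite /R (negPf ij).
apply/idP/eqP => [Rij|cij].
  have eqR : R i =1 R j.
    by move=> k; apply/idP/idP; apply: Rtr; rewrite // Rsym.
  rewrite /c (eq_pick eqR); case: pickP => //= /(_ j).
  by rewrite /R eqxx.
by apply: Rtr (Rc i) _; rewrite cij Rsym.
Qed.

(** Being fixed by the substitutions at non-simplicial vertices, [p] passes unchanged to both graphs
    of [ohtani]. The vertices of [B] stay isolated, hence end as singleton components; there the
    ideal is the kernel of a map to a domain. *)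
Lemma edge_ideal_nzd G (B : {set 'I_n}) p : graph G ->
  (forall u, ~~ simplicial G u -> kill (xy u) p = p) ->
  (forall w i, w \in B -> ~~ G w i) ->
  (forall c : 'I_n -> 'I_n,
    (forall w i, w \in B -> c i = c w -> i = w) -> param c p != 0) ->
  nonzerodivisor (J G) p.
Proof.
have [k] := ubnP #|[set u | ~~ simplicial G u]|.
elim: k G => // k IHk G; rewrite ltnS => leGk grG killp isoB parp.
have [simG|] := boolP [forall v, simplicial G v].
  have [c Gc] := simplicial_cliques grG (forallP simG).
  have := parp c; rewrite (eq_edge_ideal K Gc) => nz f /param_cliques.
  rewrite rmorphM => /eqP; rewrite mulf_eq0 => /orP [|/eqP]; last exact: param_ker.
  apply: contraTeq => _; apply: nz => w i wB ciw; apply: contraTeq (isoB w i wB) => iw.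
  by rewrite negbK Gc /cliques /= eq_sym iw ciw eqxx.
rewrite negb_forall => /existsP [u nsu].
have IH G' : graph G' -> (forall v, simplicial G v || (v == u) -> simplicial G' v) ->
    (forall w i, w \in B -> ~~ G' w i) -> nonzerodivisor (J G') p.
  move=> grG' simG' isoB'; apply: IHk => //; last first.
    by move=> v nsv; apply: killp; apply: contra nsv => sv; rewrite simG' ?sv.
  apply: leq_trans leGk; apply: proper_card; apply/properP; split.
    by apply/subsetP => v; rewrite !inE; apply: contra => sv; rewrite simG' ?sv.
  by exists u; rewrite !inE // negbK simG' ?eqxx ?orbT.
move=> f Jpf; apply/(ohtani u f grG).
have [Jc Jd] := (ohtani u _ grG).1 Jpf; split.
  apply: IH Jc => //; [exact: complete_at_graph | |].
    by move=> v; apply: complete_at_simplicial.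
  move=> w i wB; rewrite /complete_at /= (negPf (isoB w i wB)) /=.
  by rewrite [G u w](proj1 grG) (negPf (isoB w u wB)) andbF.
move: Jd; rewrite rmorphM /= killp //; apply: IH; first exact: del_vertex_graph.
  by move=> v; apply: del_vertex_simplicial.
by move=> w i wB; rewrite /del_vertex /= (negPf (isoB w i wB)) !andbF.
Qed.

Lemma mpolyX_neq0 N (m : 'X_{1..N}) : 'X_[m] != 0 :> {mpoly K[N]}.
Proof. by rewrite -msize_poly_eq0 msizeX. Qed.

Lemma isolated_simplicial G v : (forall i, ~~ G v i) -> simplicial G v.
Proof. by move=> isov; apply/simplicialP => i j; rewrite (negPf (isov i)). Qed.

Lemma var_nzd G v : graph G -> simplicial G v ->
  nonzerodivisor (J G) (x v) /\ nonzerodivisor (J G) (y v).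
Proof.
move=> grG sv; split.
  apply: (edge_ideal_nzd (B := set0)) => // [u nsu|w i|c _]; rewrite ?inE //.
    rewrite killx !inE !eq_shift orbF; case: eqP => // vu.
    by rewrite -vu sv in nsu.
  by rewrite param_x mulf_neq0 ?mpolyX_neq0.
apply: (edge_ideal_nzd (B := set0)) => // [u nsu|w i|c _]; rewrite ?inE //.
  rewrite killy !inE !eq_shift /=; case: eqP => // vu.
  by rewrite -vu sv in nsu.
by rewrite param_y mulf_neq0 ?mpolyX_neq0.
Qed.

(** The image of the binomial is a_v a_w (s_(c v) t_(c w) - s_(c w) t_(c v)), which is nonzero
    because [w] is alone in its component. *)
Lemma pendant_nzd G v w : graph G -> simplicial G v -> (forall i, ~~ G w i) ->
  v != w -> nonzerodivisor (J G) (eb v w).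
Proof.
move=> grG sv isow vw.
apply: (edge_ideal_nzd (B := [set w])) => // [u nsu|w' i /set1P -> //|c sepw].
  rewrite kill_edge_binomial; case: ifP => // /orP [] /eqP uE.
    by rewrite -uE sv in nsu.
  by rewrite -uE isolated_simplicial in nsu.
rewrite /edge_binomial raddfB /= !rmorphM /= !param_x !param_y.
rewrite -!mpolyXD; apply: contraTneq isT => /(congr1 (mcoeff
  (U_(va v) + U_(vs (c v)) + (U_(va w) + U_(vt (c w))))%MM)).
rewrite mcoeff0 mcoeffB !mcoeffX eqxx; case: eqP => [/mnmP /(_ (vs (c v)))|_].
  rewrite !mnmDE !mnm1E !eq_shift eqxx; case: eqP => //= cwv.
  by have := sepw w v (set11 w) (esym cwv) => vw'; rewrite vw' eqxx in vw.
by rewrite subr0 => /eqP; rewrite oner_eq0.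
Qed.

(** * Hilbert series of graphs *)

(** No generator involves the variables of an isolated vertex, so both can be killed in turn, each
    contributing a factor [1 - 'X]. *)
Lemma hilb_kill_vertex G v q : graph G -> (forall i, ~~ G v i) ->
  hilb_numerator (J G) q ->
  graded (fun f => J G (kill (xy v) f)) /\
  hilb_numerator (fun f => J G (kill (xy v) f)) ((1 - 'X) ^+ 2 * q).
Proof.
move=> grG isov Jq; have [symG _] := grG; have idJ := edge_ideal_ideal K G.
have [nzx nzy] := var_nzd grG (isolated_simplicial isov).
have killJ (D : {set 'I_(n + n)}) f : D \subset xy v -> J G f -> J G (kill D f).
  move=> Dv; apply: (edge_idealP (kill_ideal D idJ)) => i j Gij.
  suff -> : kill D (eb i j) = eb i j by apply: edge_ideal_gen.
  have iv : i != v by apply: contraTneq Gij => ->.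
  have jv : j != v by apply: contraTneq Gij => ->; rewrite symG.
  have notD k : k != v -> (lshift n k \notin D) * (rshift n k \notin D).
    by move=> /negPf kv; split; apply: contraFN kv => /(subsetP Dv);
       rewrite !inE !eq_shift ?orbF.
  rewrite /edge_binomial raddfB /= !rmorphM /= !killx !killy.
  by rewrite !(negPf (notD _ iv).1) !(negPf (notD _ jv).1)
    !(negPf (notD _ iv).2) !(negPf (notD _ jv).2).
have [|grx numx] := hilb_numerator_kill1 idJ (edge_ideal_graded symG) _ nzx Jq.
  by move=> f; apply: killJ; rewrite sub1set !inE eqxx.
have [||gry numy] := hilb_numerator_kill1 (kill_ideal _ idJ) grx _ _ numx (i := rshift n v).
- move=> f Jf; rewrite killU setUC -killU; apply: killJ Jf.
  by rewrite sub1set !inE eqxx orbT.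
- by move=> f; rewrite rmorphM /= killX inE eq_shift => /nzy.
have eqk f : J G (kill [set lshift n v] (kill [set rshift n v] f)) <-> J G (kill (xy v) f).
  by rewrite killU.
split=> [d f /eqk|]; first by move=> /gry h; apply/eqk.
apply: eq_hilb_numerator eqk _ numy.
  exact: kill_ideal (kill_ideal _ idJ).
by rewrite mulrA expr2.
Qed.

(** Inclusion-exclusion for [ohtani] and [ohtani_add], solved for the completed graph. The square
    comes from the two variables of the deleted vertex. *)
Lemma hilb_ohtani G v q q' q'' : graph G ->
  hilb_numerator (J G) q -> hilb_numerator (J (del_vertex (complete_at G v) v)) q' ->
  hilb_numerator (J (del_vertex G v)) q'' ->
  hilb_numerator (J (complete_at G v)) (q + (1 - 'X) ^+ 2 * (q' - q'')).
Proof.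
move=> grG Gq Gq' Gq''; have grG' := complete_at_graph v grG.
have isov (H : rel 'I_n) i : ~~ del_vertex H v v i by rewrite /del_vertex /= eqxx.
have [_ numq'] := hilb_kill_vertex (del_vertex_graph v grG') (isov _) Gq'.
have [gr'' numq''] := hilb_kill_vertex (del_vertex_graph v grG) (isov _) Gq''.
have idd H := kill_ideal (xy v) (edge_ideal_ideal K (del_vertex H v)).
have idc := edge_ideal_ideal K (complete_at G v).
rewrite mulrBr addrA; apply: hilb_numerator_cap gr'' _ _ numq'' => //.
- by apply: edge_ideal_graded; case: grG'.
- apply: eq_hilb_numerator Gq => //; first exact: edge_ideal_ideal.
  by move=> f; apply: ohtani.
apply: eq_hilb_numerator numq' => //.
by move=> f; apply: iff_sym; apply: ohtani_add.
Qed.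

Definition add_edge G v w : rel 'I_n :=
  [rel i j | [|| G i j, (i == v) && (j == w) | (i == w) && (j == v)]].

Lemma add_edge_graph G v w : graph G -> v != w -> graph (add_edge G v w).
Proof.
move=> [symG irrG] vw; split=> [i j|i]; rewrite /add_edge /=.
  by rewrite symG orbCA orbC -!orbA ![(j == _) && _]andbC orbCA orbA orbC.
rewrite irrG /=; apply/negP => /orP [] /andP [/eqP -> /eqP vw'];
by rewrite vw' eqxx in vw.
Qed.

Lemma hilb_pendant G v w q : graph G -> simplicial G v -> (forall i, ~~ G w i) ->
  v != w -> hilb_numerator (J G) q ->
  hilb_numerator (J (add_edge G v w)) ((1 - 'X^2) * q).
Proof.
move=> grG sv isow vw Gq; have [symG irrG] := grG.
have [symG' _] := add_edge_graph grG vw.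
have idJ := edge_ideal_ideal K G; have idJ' := edge_ideal_ideal K (add_edge G v w).
apply: (@eq_hilb_numerator _ _ (ideal_add_gen (J G) (eb v w))) (erefl _) _.
- exact: ideal_add_gen_ideal.
- move=> f; split=> [[a Ja]|].
    rewrite -[f](subrK (a * eb v w)); apply: idealD => //.
      by apply: edge_idealS Ja => // i j Gij; rewrite /add_edge /= Gij.
    by apply: idealM => //; apply: edge_ideal_gen => //; rewrite /add_edge /= !eqxx orbT.
  apply: edge_idealP => [|i j]; first exact: ideal_add_gen_ideal.
  rewrite /add_edge /= => /or3P [Gij|/andP [/eqP -> /eqP ->]|/andP [/eqP -> /eqP ->]].
  - by exists 0; rewrite mul0r subr0; apply: edge_ideal_gen.
  - by exists 1; rewrite mul1r subrr; apply: ideal0.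
  by exists (- 1); rewrite edge_binomialC mulN1r opprK addNr; apply: ideal0.
apply: hilb_numerator_add_gen => //; first exact: edge_ideal_graded.
  exact: edge_binomial_homog.
exact: pendant_nzd.
Qed.

End Ohtani.

(** * Hilbert series of complete graphs and of cliques with handles *)

Section CliquesWithHandles.
Variables (K : fieldType) (n : nat).
Local Notation J := (@edge_ideal K n).
Implicit Types (G H : rel 'I_n) (u v w i j : 'I_n) (A B C : {set 'I_n}).

(** Vertices outside [A] remain as isolated vertices, so the polynomial ring does not change. *)
Definition induced G A : rel 'I_n := [rel i j | [&& i \in A, j \in A & G i j]].

Definition complete_on A : rel 'I_n := induced [rel i j | i != j] A.

Lemma induced_graph G A : graph G -> graph (induced G A).
Proof.
case=> symG irrG; split=> [i j|i]; rewrite /induced /=.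
  by rewrite symG andbCA.
by rewrite irrG !andbF.
Qed.

Lemma complete_on_graph A : graph (complete_on A).
Proof.
by apply: induced_graph; split=> [i j|i] /=; rewrite ?eqxx // eq_sym.
Qed.

(** The series (1 + (m - 1)t) / (1 - t)^(m + 1) of [K_m], put over the denominator (1 - t)^(2m);
    isolated vertices do not affect the numerator. *)
Definition complete_numerator m : {poly int} :=
  (m.-1%:R * 'X + 1) * (1 - 'X) ^+ m.-1.

(** Completing at [v] the clique on [A :\ w] with pendant edge [vw] gives the clique on [A]. Hence
    the numerators satisfy c_(m+1) = (1 - t^2) c_m + (1 - t)^2 (c_m - c_(m-1)). *)
Lemma hilb_complete A : (0 < #|A|)%N ->
  hilb_numerator (J (complete_on A)) (complete_numerator #|A|).
Proof.
have [k] := ubnP #|A|; elim: k A => // k IHk A; rewrite ltnS => leAk A0.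
have /set0Pn [w wA] : A != set0 by rewrite -card_gt0.
have cardA : #|A| = #|A :\ w|.+1 by rewrite (cardsD1 w) wA.
have [A'0|[v]] := set_0Vmem (A :\ w).
  have -> : complete_numerator #|A| = 1.
    by rewrite cardA A'0 cards0 /complete_numerator /= mul0r add0r mul1r expr0.
  apply: eq_hilb_numerator (@zero_ideal K (n + n)) _ (erefl _) (@hilb_numerator0 _ _).
  have A1 i : i \in A -> i = w.
    by move=> iA; move/setP/(_ i): A'0; rewrite !inE iA andbT => /negbFE/eqP.
  move=> f; split=> [->|]; first by apply: ideal0; apply: edge_ideal_ideal.
  apply: (edge_idealP (I := fun f => f = 0)) => [|i j]; first exact: zero_ideal.
  by case/and3P => /A1 -> /A1 ->; rewrite /= eqxx.
move=> vA'; have [vw vA] : v != w /\ v \in A by move: vA'; rewrite !inE => /andP.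
have cardA' : #|A :\ w| = #|A :\ w :\ v|.+1 by rewrite (cardsD1 v (A :\ w)) vA'.
pose G := complete_on (A :\ w); have grG := complete_on_graph (A :\ w).
have simv : simplicial G v.
  by apply/simplicialP => i j /and3P [_ iA _] /and3P [_ jA _] ij; apply/and3P.
have isow i : ~~ G w i by rewrite /G /complete_on /induced /= !inE eqxx.
have GP : hilb_numerator (J (add_edge G v w))
    ((1 - 'X^2) * complete_numerator #|A :\ w|).
  apply: hilb_pendant => //; apply: IHk; first by rewrite -cardA.
  by rewrite cardA'.
(* If [A] is just [v] and [w], the pendant edge is already the whole clique; the recurrence would
   call for the empty clique. *)
have [A''0|A''N] := posnP #|A :\ w :\ v|.
  have eqG : J (complete_on A) = J (add_edge G v w).
    apply: eq_edge_ideal => i j; rewrite /add_edge /G /complete_on /induced /= !inE.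
    have A2 l : (l \in A) = (l == v) || (l == w).
      have := cards0_eq A''0 => /setP/(_ l); rewrite !inE.
      case: (eqVneq l v) => [->|_]; first by rewrite vA.
      by case: (eqVneq l w) => [->|_]; [rewrite wA | rewrite /= => ->].
    have [wv vwF] : (w == v) = false /\ (v == w) = false by rewrite eq_sym (negPf vw).
    rewrite !A2; case: (eqVneq i w) => [->|iw]; case: (eqVneq j w) => [->|jw];
      rewrite ?wv ?orbF ?orbT ?eqxx ?andbF //=.
    - by rewrite andbT.
    - by rewrite iw !andbT.
    by case: (eqVneq i v) => // ->; case: (eqVneq j v) => // ->; rewrite eqxx.
  rewrite eqG; apply: eq_hilb_numerator GP => //; first exact: edge_ideal_ideal.
  rewrite cardA cardA' A''0 /complete_numerator /=; ring.
have eqG : complete_at (add_edge G v w) v =2 complete_on A.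
  have wv : (w == v) = false by rewrite eq_sym (negPf vw).
  have Gv i : add_edge G v w v i = (i != v) && (i \in A).
    rewrite /add_edge /G /complete_on /induced /= !inE eqxx vA (negPf vw) /= orbF.
    by case: (eqVneq i w) => [->|_]; rewrite ?wv ?wA //= orbF eq_sym andbC.
  move=> i j; rewrite /complete_at /= !Gv /add_edge /G /complete_on /induced /= !inE.
  case: (eqVneq i w) => [->|iw]; case: (eqVneq j w) => [->|jw];
    rewrite ?wv ?eqxx ?wA ?orbF ?andbF ?andbT //=.
  - by case: (eqVneq j v) => [->|]; rewrite ?vA ?wv //= (eq_sym w j) jw ?andbT.
  - by case: (eqVneq i v) => [->|]; rewrite ?vA ?vw ?iw ?andbT.
  by case: (i \in A); case: (j \in A); rewrite /= ?andbF // !andbT;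
     case: eqP; rewrite ?andbF.
rewrite -(eq_edge_ideal K eqG).
have del_complete B : del_vertex (complete_on B) v =2 complete_on (B :\ v).
  move=> i j; rewrite /del_vertex /complete_on /induced /= !inE.
  by rewrite -!andbA; do !bool_congr.
have delG : del_vertex (add_edge G v w) v =2 complete_on (A :\ w :\ v).
  move=> i j; rewrite -del_complete /del_vertex /add_edge /=.
  by case: (eqVneq i v) => //= _; case: (eqVneq j v) => //= _; rewrite !andbF !orbF.
have delG' : del_vertex (complete_at (add_edge G v w) v) v =2 complete_on (A :\ v).
  by move=> i j; rewrite -del_complete /del_vertex /= -eqG.
have cardAv : #|A :\ v| = #|A :\ w|.
  by move: (cardsD1 v A) (cardsD1 w A); rewrite vA wA; lia.
have H1 : hilb_numerator (J (del_vertex (complete_at (add_edge G v w) v) v))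
    (complete_numerator #|A :\ v|).
  by rewrite (eq_edge_ideal K delG'); apply: IHk; rewrite cardAv ?cardA' // -cardA'; lia.
have H2 : hilb_numerator (J (del_vertex (add_edge G v w) v))
    (complete_numerator #|A :\ w :\ v|).
  by rewrite (eq_edge_ideal K delG); apply: IHk => //; lia.
have := hilb_ohtani (add_edge_graph grG vw) GP H1 H2.
apply: eq_hilb_numerator => //; first exact: edge_ideal_ideal.
rewrite cardAv cardA cardA'; case: #|A :\ w :\ v| A''N => // k' _.
rewrite /complete_numerator /= -[k'.+2%:R]natr1 -[k'.+1%:R]natr1 !exprS; ring.
Qed.

(** A highest handle vertex [w] of [A] is a leaf at [par w]. Without [w], the neighbours of [par w]
    lie in [C] if [par w] does, and otherwise only [par (par w)] can remain. *)
Lemma induced_pendant G C (par : 'I_n -> 'I_n) (ht : 'I_n -> nat) A w :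
  graph G ->
  (forall i j, i \in C -> j \in C -> G i j = (i != j)) ->
  (forall i j, i \notin C -> G i j = (par i == j) || (j \notin C) && (par j == i)) ->
  (forall i j, i \notin C -> j \notin C -> par i = par j -> i = j) ->
  (forall i, i \notin C -> (ht (par i) < ht i)%N) ->
  w \in A -> w \notin C -> par w \in A ->
  (forall i, i \in A -> i \notin C -> (ht i <= ht w)%N) ->
  [/\ simplicial (induced G (A :\ w)) (par w), par w != w
    & induced G A =2 add_edge (induced G (A :\ w)) (par w) w].
Proof.
move=> [symG irrG] GC Gpar par_inj ht_par wA wC vA max_w.
have vw : par w != w by apply: contraTneq (ht_par w wC) => ->; rewrite ltnn.
have child i : i \notin C -> par i = par w -> i = w.
  by move=> iC; apply: par_inj.
split=> //.
  apply/simplicialP => i j; rewrite /induced /= !inE.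
  move=> /and3P [_ /andP [iw iA] vi] /and3P [_ /andP [jw jA] vj] ij.
  rewrite iw jw iA jA /=.
  have [vC|vC] := boolP (par w \in C).
    have nC l : l != w -> G (par w) l -> l \in C.
      move=> lw; rewrite symG; apply: contraTT => lC; rewrite Gpar // vC /= orbF.
      by apply: contra lw => /eqP plw; rewrite (child l).
    by rewrite GC // nC.
  have nC l : l != w -> G (par w) l -> par (par w) = l.
    move=> lw; rewrite Gpar // => /orP [/eqP //|/andP [lC /eqP plw]].
    by rewrite (child l lC plw) eqxx in lw.
  by move: ij; rewrite -(nC i iw vi) -(nC j jw vj) eqxx.
have Gw j : j \in A -> G w j = (j == par w).
  move=> jA; rewrite Gpar // eq_sym; case: eqP => //= _.
  apply/negP => /andP [jC /eqP pjw]; have := ht_par j jC.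
  by rewrite pjw ltnNge max_w.
move=> i j; rewrite /induced /add_edge /= !inE.
have [->|iw] := eqVneq i w; have [->|jw] := eqVneq j w;
  rewrite ?wA ?andbF ?orbF ?andbT //=.
- by rewrite irrG eq_sym (negPf vw).
- by case: (boolP (j \in A)) => [/Gw //|];
     case: eqP => // ->; rewrite vA.
by rewrite symG; case: (boolP (i \in A)) => [/Gw //|];
   case: eqP => // ->; rewrite vA.
Qed.

(* [par] is the neighbour of a handle vertex on the side of the clique [C], and
   [ht] is a height along the handles. *)
Lemma hilb_handles G C (par : 'I_n -> 'I_n) (ht : 'I_n -> nat) :
  graph G -> (0 < #|C|)%N ->
  (forall i j, i \in C -> j \in C -> G i j = (i != j)) ->
  (forall i j, i \notin C -> G i j = (par i == j) || (j \notin C) && (par j == i)) ->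
  (forall i j, i \notin C -> j \notin C -> par i = par j -> i = j) ->
  (forall i, i \notin C -> (ht (par i) < ht i)%N) ->
  hilb_numerator (J G) ((1 - 'X^2) ^+ (n - #|C|) * complete_numerator #|C|).
Proof.
move=> grG C0 GC Gpar par_inj ht_par.
(* The statement is generalised to the parent-closed sets between [C] and the whole graph, from
   which highest vertices are stripped one by one. *)
suff ind A : C \subset A -> (forall i, i \in A -> i \notin C -> par i \in A) ->
    hilb_numerator (J (induced G A))
      ((1 - 'X^2) ^+ #|A :\: C| * complete_numerator #|C|).
  have := ind setT (subsetT C) (fun i _ _ => in_setT _).
  apply: eq_hilb_numerator; first exact: edge_ideal_ideal.
    by move=> f; rewrite (@eq_edge_ideal K n _ G) // => i j; rewrite /induced /= !inE.
  by rewrite setTD cardsCs setCK card_ord.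
have [k] := ubnP #|A :\: C|; elim: k A => // k IHk A; rewrite ltnS => leAk CA closedA.
have [AC0|[w0 w0A]] := set_0Vmem (A :\: C).
  have -> : A = C by apply/eqP; rewrite eqEsubset CA -setD_eq0 AC0 eqxx.
  rewrite setDv cards0 expr0 mul1r (@eq_edge_ideal K n _ (complete_on C)).
    exact: hilb_complete.
  move=> i j; rewrite /complete_on /induced /=.
  by case: (boolP (i \in C)) => //= iC; case: (boolP (j \in C)) => //= jC; rewrite GC.
case: (@arg_maxnP _ w0 (fun i => i \in A :\: C) ht w0A) => w.
rewrite inE => /andP [wC wA] maxw.
have max_w i : i \in A :\: C -> (ht i <= ht w)%N by apply: maxw.
have vA : par w \in A by apply: closedA.
have [|simv vw eqG] := induced_pendant grG GC Gpar par_inj ht_par wA wC vA.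
  by move=> i iA iC; apply: max_w; rewrite inE iC.
have cardA : #|A :\: C| = #|A :\ w :\: C|.+1.
  rewrite (cardsD1 w) !inE wC wA add1n; congr (#|pred_of_set _|.+1).
  by apply/setP => i; rewrite !inE andbCA.
rewrite (eq_edge_ideal K eqG) cardA exprS -mulrA.
apply: hilb_pendant => //; first exact: induced_graph.
  by move=> i; rewrite /induced /= !inE eqxx.
apply: IHk; first by rewrite -cardA.
  by apply/subsetP => i iC; rewrite !inE (subsetP CA) // andbT; apply: contraNneq wC => <-.
move=> i; rewrite !inE => /andP [iw iA] iC; rewrite closedA // andbT.
apply/eqP => piw; have := ht_par i iC; rewrite piw ltnNge max_w //.
by rewrite inE iC.
Qed.

End CliquesWithHandles.

(** The second hypothesis is the equality of fractions q / (1 - t)^N = p / (1 - t)^d with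
    denominators cleared. *)
Lemma poly_series_frac (K : fieldType) N (h : nat -> int) q p d :
  (forall e, h e = mul_poly_series q (poly_series K N) e) ->
  (1 - 'X) ^+ d * q = p * (1 - 'X) ^+ N -> series_eq_frac h p d.
Proof.
move=> hq qp e; rewrite (eq_mps _ (fun i _ => hq i)) -mpsM qp mpsM.
rewrite (eq_mps _ (fun i _ => poly_seriesP K N i)).
rewrite /mul_poly_series (bigD1 ord_max) //= subnn mulr1 big1 ?addr0 // => i ie.
by rewrite subn_eq0 leqNgt ltn_neqAle -ltnS ltn_ord andbT ie mulr0.
Qed.

(** * The Hilbert series of a quotient ring in terms of [hdim] *)

Section HilbertSeriesOfQuotient.
Variables (K : fieldType) (N : nat) (I : idealr {mpoly K[N]}).

Lemma idealr_is_ideal : is_ideal (fun f => f \in I).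
Proof. by split=> [|f g|a f]; [exact: rpred0 | exact: rpredD | exact: idealMr]. Qed.

Lemma quot_pi_eq0 (f : {mpoly K[N]}) : (\pi_{ideal_quot I} f == 0) = (f \in I).
Proof. by rewrite -[0](rmorph0 (\pi_{ideal_quot I})) -Quotient.idealrBE subr0. Qed.

Lemma quot_pi_comb (T : finType) (c : T -> K) (b : T -> {mpoly K[N]}) :
  \sum_i c i *: \pi_{ideal_quot I} (b i) = \pi_{ideal_quot I} (\sum_i c i *: b i).
Proof.
rewrite rmorph_sum; apply: eq_bigr => i _.
by rewrite -mul_mpolyC rmorphM.
Qed.

Lemma hilbert_seriesE d : hilbert_series I d = (hdim (fun f => f \in I) d)%:Z.
Proof.
have idI := idealr_is_ideal; congr Posz; rewrite /dimK.
(* The junk value of [dimK] does not occur: a basis modulo [I] maps to a basis of the component. *)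
case: pselect => [e|[]]; last first.
  have [b [hb spanb indb]] := hdimP d idI; exists (hdim (fun f => f \in I) d).
  exists (fun i => \pi_{ideal_quot I} (b i)); split=> [i|v [f hf ->]|c].
  - by exists (b i).
  - have [c Ic] := spanb f hf; exists c; rewrite quot_pi_comb.
    by apply/eqP; rewrite -subr_eq0 -rmorphB quot_pi_eq0.
  by rewrite quot_pi_comb => /eqP; rewrite quot_pi_eq0; apply: indb.
case: (cid e) => h [b [Wb spanb indb]] /=; apply/esym/hdim_eq => //.
have /choice [b' b'P] : forall i, exists f : {mpoly K[N]},
    f \is d.-homog /\ b i = \pi_{ideal_quot I} f.
  by move=> i; have [f] := Wb i; exists f.
have sumE c : \sum_i c i *: b i = \pi_{ideal_quot I} (\sum_i c i *: b' i).
  by rewrite -quot_pi_comb; apply: eq_bigr => i _; rewrite (b'P i).2.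
exists b'; split=> [i|f hf|c Ic]; first by case: (b'P i).
  have [|c fc] := spanb (\pi_{ideal_quot I} f); first by exists f.
  exists c; rewrite -quot_pi_eq0 rmorphB /= subr_eq0; apply/eqP.
  by rewrite -sumE -fc.
by apply: indb; apply/eqP; rewrite sumE quot_pi_eq0.
Qed.

End HilbertSeriesOfQuotient.

(** * Krull dimension *)

Lemma leq_expn a b e : (a <= b -> a ^ e <= b ^ e)%N.
Proof. by case: e => // e le_ab; rewrite leq_exp2r. Qed.

Lemma mps_sum (g : nat -> int) d :
  g d = \sum_(i < d.+1) mul_poly_series (1 - 'X) g i.
Proof.
elim: d => [|d IHd]; rewrite big_ord_recr /= mpsB mps1 -['X]expr1 mpsXn /=.
  by rewrite big_ord0 add0r subr0.
by rewrite -IHd subn1 /= addrC subrK.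
Qed.

(** Starting from the polynomial [q], [h] is obtained by [D.+1] successive partial summations. The
    first gives a sequence bounded by [s], the sum of the absolute values of the coefficients of
    [q]; each further one raises the order of growth by one. *)
Lemma series_frac_bound (h : nat -> int) q D :
  series_eq_frac h q D.+1 ->
  exists C : nat, forall d, `|h d| <= (C * d.+1 ^ D)%:Z.
Proof.
move=> hq.
suff [C bnd] : exists C : nat, forall j d, (j <= D)%N ->
    `|mul_poly_series ((1 - 'X) ^+ (D - j)) h d| <= (C * d.+1 ^ j)%:Z.
  by exists C => d; have := bnd D d (leqnn D); rewrite subnn expr0 mps1.
pose s := \sum_(0 <= i < size q) `|q`_i|.
have s_ge0 : 0 <= s by apply: sumr_ge0.
have le_s d : \sum_(0 <= i < d) `|q`_i| <= s.
  have [le_dq|lt_qd] := leqP d (size q).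
    by rewrite /s [leRHS](big_cat_nat (n := d)) //= lerDl sumr_ge0.
  rewrite [leLHS](big_cat_nat (n := size q)) ?(ltnW lt_qd) //=.
  rewrite [X in _ + X]big_nat_cond [X in _ + X]big1 ?addr0 // => i.
  by rewrite andbT => /andP [le_qi _]; rewrite nth_default ?normr0.
exists `|s|%N; elim=> [|j IHj] d lt_jD.
  rewrite expn0 muln1 gez0_abs // subn0 mps_sum.
  under eq_bigr => i _ do rewrite -mpsM -exprS hq.
  apply: le_trans (ler_norm_sum _ _ _) _.
  by rewrite -(big_mkord predT (fun i => `|q`_i|)).
rewrite mps_sum.
under eq_bigr => i _ do rewrite -mpsM -exprS -subSn // subSS.
apply: le_trans (ler_norm_sum _ _ _) _.
apply: (@le_trans _ _ (\sum_(i < d.+1) (`|s| * d.+1 ^ j)%:Z)).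
  apply: ler_sum => i _; apply: le_trans (IHj _ (ltnW lt_jD)) _.
  by rewrite lez_nat leq_mul // leq_expn // ltn_ord.
rewrite sumr_const card_ord expnSr mulnA [leRHS]PoszM.
by rewrite -mulr_natr natz.
Qed.

Section PrimeChains.
Variable (K : fieldType).

Definition is_prime (R : comNzRingType) (P : R -> Prop) : Prop :=
  [/\ P 0, ~ P 1, forall f g, P f -> P g -> P (f + g), forall a f, P f -> P (a * f)
    & forall f g, P (f * g) -> P f \/ P g].

Lemma prime_exp (R : comNzRingType) (P : R -> Prop) f e :
  is_prime P -> P (f ^+ e) -> P f.
Proof.
case=> _ P1 _ _ PM; elim: e => [|e IHe]; first by rewrite expr0 => /P1.
by rewrite exprS => /PM [].
Qed.

Lemma prime_is_ideal N (P : {mpoly K[N]} -> Prop) : is_prime P -> is_ideal P.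
Proof. by case. Qed.

(* Compare the terms of lowest degree in [F k]. *)
Lemma chain_independent (N : nat) (P : nat -> {mpoly K[N]} -> Prop)
    (F : nat -> {mpoly K[N]}) d (T : finType) (a : T -> nat -> nat) (c : T -> K) :
  (forall k, (k <= d)%N -> is_prime (P k)) ->
  (forall k f, (k < d)%N -> P k f -> P k.+1 f) ->
  (forall k, (k < d)%N -> P k.+1 (F k) /\ ~ P k (F k)) ->
  forall k (B : {set T}), (k <= d)%N -> B != set0 -> {in B, forall t, c t != 0} ->
  {in B &, forall t t', (forall i, (k <= i < d)%N -> a t i = a t' i) -> t = t'} ->
  ~ P k (\sum_(t in B) c t *: \prod_(k <= i < d) F i ^+ a t i).
Proof.
move=> prP incP FP k; have [j] := ubnP (d - k); elim: j k => // j IHj k.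
rewrite ltnS => le_j B le_kd /set0Pn [t0 t0B] cB injB.
have [lt_kd|le_dk] := ltnP k d; last first.
  have [P0 P1 _ PM _] := prP k le_kd.
  have -> : B = [set t0].
    apply/setP => t; rewrite inE; apply/idP/eqP => [tB|-> //].
    by apply: injB => // i /andP [? ?]; lia.
  rewrite big_set1 big_geq // => Pc; apply: P1.
  have -> : 1 = (c t0)^-1%:MP * (c t0 *: 1) :> {mpoly K[N]}.
    by rewrite mul_mpolyC scalerA mulVf ?cB // scale1r.
  exact: PM.
have [t1 t1B mine] : exists2 t1, t1 \in B & {in B, forall t, (a t1 k <= a t k)%N}.
  case: (@arg_minnP _ t0 (mem B) (a^~ k) t0B) => t1 t1B le_t1.
  by exists t1.
set e := a t1 k in mine; have [PFk nPFk] := FP k lt_kd.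
pose mon t := \prod_(k.+1 <= i < d) F i ^+ a t i.
have -> : \sum_(t in B) c t *: \prod_(k <= i < d) F i ^+ a t i =
    F k ^+ e * \sum_(t in B) c t *: (F k ^+ (a t k - e) * mon t).
  rewrite mulr_sumr; apply: eq_bigr => t tB.
  by rewrite (big_ltn lt_kd) -scalerAr mulrA -exprD subnKC ?mine.
(* The power of [F k] cancels as [F k] is outside the prime [P k]. Since [F k] lies in [P k.+1],
   only the terms with minimal exponent [e] survive modulo [P k.+1]. *)
case: (prP k le_kd) => _ _ _ _ PM /PM [/(prime_exp (prP k le_kd)) //|].
move=> /(incP k _ lt_kd); have idP' := prime_is_ideal (prP k.+1 lt_kd).
rewrite (bigID (fun t => a t k == e)) /= => PB.
have {}PB : P k.+1 (\sum_(t in B | a t k == e) c t *: (F k ^+ (a t k - e) * mon t)).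
  have := idealB idP' PB; rewrite -[X in _ -> P _ X](addrK (\sum_(t in B | a t k != e)
    c t *: (F k ^+ (a t k - e) * mon t))); apply.
  apply: (ideal_sum _ idP') => t /andP [tB ne].
  have -> : (a t k - e = (a t k - e).-1.+1)%N.
    by rewrite prednK // subn_gt0 ltn_neqAle eq_sym ne mine.
  rewrite -mul_mpolyC exprS -mulrA mulrCA -[X in P _ X]mulrC.
  exact: idealM.
pose B' := [set t in B | a t k == e].
apply: (IHj k.+1 _ B') => //.
- by rewrite ltn_subLR; lia.
- by apply/set0Pn; exists t1; rewrite inE t1B /=.
- by move=> t; rewrite inE => /andP [/cB].
- move=> t t'; rewrite !inE => /andP [tB /eqP te] /andP [tB' /eqP te'] eqa.
  apply: injB => // i; rewrite leq_eqVlt => /andP [/orP [/eqP <-|ki] id].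
    by rewrite te te'.
  by apply: eqa; rewrite ki.
rewrite (eq_bigl (fun t => (t \in B) && (a t k == e))) => [|t]; last by rewrite inE.
rewrite (eq_bigr (fun t => c t *: (F k ^+ (a t k - e) * mon t))) // => t.
by case/andP => _ /eqP ->; rewrite subnn expr0 mul1r.
Qed.

Lemma msizeM_le N (f g : {mpoly K[N]}) a b :
  (msize f <= a.+1 -> msize g <= b.+1 -> msize (f * g) <= (a + b).+1)%N.
Proof.
have [->|f0] := eqVneq f 0; first by rewrite mul0r msize0.
have [->|g0] := eqVneq g 0; first by rewrite mulr0 msize0.
rewrite msizeM // => fa gb; have := leq_add fa gb.
by rewrite addSn addnS; case: (_ + _)%N.
Qed.

Lemma msizeXn_le N (f : {mpoly K[N]}) a e :
  (msize f <= a.+1 -> msize (f ^+ e) <= (a * e).+1)%N.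
Proof.
move=> fa; elim: e => [|e IHe]; first by rewrite expr0 msize1.
by rewrite exprS mulnS; apply: msizeM_le.
Qed.

Lemma msize_prod_le N (F : nat -> {mpoly K[N]}) (a : nat -> nat) c k d :
  (forall i, (i < d)%N -> msize (F i) <= c.+1)%N -> (forall i, (i < d)%N -> a i <= k)%N ->
  (msize (\prod_(0 <= i < d) F i ^+ a i) <= (c * k * d).+1)%N.
Proof.
elim: d => [|d IHd] Fc ak; first by rewrite big_geq // msize1.
rewrite big_nat_recr //= mulnSr; apply: msizeM_le.
  by apply: IHd => i id; [apply: Fc | apply: ak]; rewrite ltnS ltnW.
apply: leq_trans (msizeXn_le _ (Fc d (ltnSn d))) _.
by rewrite ltnS leq_mul2l ak ?orbT.
Qed.

(** Spanning families of the components of degree less than [D] are put together; [msize f <= D]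
    bounds the degree of [f] by [D - 1] for nonzero [f]. *)
Lemma truncation_spanned N (I : {mpoly K[N]} -> Prop) D : is_ideal I ->
  exists (T : finType) (b : T -> {mpoly K[N]}),
    #|T| = (\sum_(i < D) hdim I i)%N /\
    forall f, (msize f <= D)%N -> exists c : T -> K, I (f - \sum_t c t *: b t).
Proof.
move=> idI.
have exb : forall i : 'I_D, exists b : 'I_(hdim I i) -> {mpoly K[N]},
    forall f, f \is i.-homog -> exists c, I (f - \sum_j c j *: b j).
  by move=> i; have [b [_ spanb _]] := hdimP i idI; exists b.
pose b i := projT1 (cid (exb i)); have bP i := projT2 (cid (exb i)).
exists {i : 'I_D & 'I_(hdim I i)}, (fun t => b (tag t) (tagged t)); split.
  by rewrite card_tagged sumnE big_map big_enum; apply: eq_bigr => i _; rewrite card_ord.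
move=> f fD.
have exc (i : 'I_D) := bP i _ (pihomogP mdeg i f).
pose c i := projT1 (cid (exc i)); have cP i := projT2 (cid (exc i)).
exists (fun t => c (tag t) (tagged t)).
rewrite (pihomog_partitionE fD).
rewrite -(sig_big_dep predT (fun _ _ => true) (fun i j => c i j *: b i j)) /=.
by rewrite -sumrB; apply: ideal_sum.
Qed.

Lemma krull_upper_bound (N : nat) (I : idealr {mpoly K[N]}) q D :
  series_eq_frac (hilbert_series I) q D.+1 ->
  forall d (p : 'I_d.+1 -> prime_idealr {ideal_quot I}), prime_chain p -> (d <= D.+1)%N.
Proof.
move=> /series_frac_bound [C bndC] d p chainp.
have {}bndC e : (hdim (fun f => f \in I) e <= C * e.+1 ^ D)%N.
  by have := bndC e; rewrite hilbert_seriesE ger0_norm // lez_nat.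
have idI := idealr_is_ideal I.
pose P k (f : {mpoly K[N]}) : Prop := \pi_{ideal_quot I} f \in p (inord k).
have prP k : is_prime (P k).
  split.
  - by rewrite /P rmorph0 idealr0.
  - by rewrite /P rmorph1 idealr1.
  - by move=> f g; rewrite /P rmorphD => Pf Pg; apply: rpredD.
  - by move=> a f; rewrite /P rmorphM; apply: idealMr.
  by move=> f g; rewrite /P rmorphM prime_idealrM => /orP.
have IP f : f \in I -> P 0%N f by rewrite /P -quot_pi_eq0 => /eqP ->; apply: idealr0.
have lt_inord k : (k < d)%N -> ((inord k : 'I_d.+1) < (inord k.+1 : 'I_d.+1))%N.
  by move=> kd; rewrite !inordK // ltnW.
have incP k f : (k < d)%N -> P k f -> P k.+1 f.
  by move=> /lt_inord /chainp [sub _]; apply: sub.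
have /choice [F FP] : forall k, exists f, (k < d)%N -> P k.+1 f /\ ~ P k f.
  move=> k; have [kd|] := ltnP k d; last by exists 0.
  have [_ nsub] := chainp _ _ (lt_inord k kd).
  apply: contrapT => nex; apply: nsub => a pa; apply: contrapT => npa.
  by apply: nex; exists (repr a) => _; rewrite /P reprK.
pose c := (\max_(i < d) msize (F i))%N.
have Fc i : (i < d)%N -> (msize (F i) <= c.+1)%N.
  by move=> id; apply: leqW; apply: (leq_bigmax (Ordinal id)).
(* The [k ^ d] monomials in the [F i] with exponents below [k] have degree at most [c * k * d] and
   are independent modulo [I]. *)
have count k : (k ^ d <= C * (c * k * d).+1 ^ D.+1)%N.
  pose e := (c * k * d)%N.
  have [T [b [cardT spanb]]] := truncation_spanned e.+1 idI.
  pose A := {ffun 'I_d -> 'I_k}.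
  pose a (t : A) i := oapp (fun j => val (t j)) 0%N (insub i).
  have ak (t : A) i : (a t i <= k)%N.
    by rewrite /a; case: insub => //= j; apply: ltnW.
  have : (#|A| <= #|T|)%N.
    apply: (independent_le_spanning (ideal_subspace idI)
      (a := fun t => \prod_(0 <= i < d) F i ^+ a t i) (b := b)) => [w Iw t|t].
      apply: contrapT => /eqP wt.
      pose B := [set t | w t != 0].
      apply: (@chain_independent N P F d A a w _ _ FP 0%N B) => //.
      - by apply/set0Pn; exists t; rewrite inE.
      - by move=> t'; rewrite inE.
      - move=> t1 t2 _ _ eqa; apply/ffunP => i; apply: val_inj.
        by have := eqa i (ltn_ord i); rewrite /a valK.
      apply: IP; move: Iw; rewrite (bigID (mem B)) /= addrC big1 ?add0r // => t'.
      by rewrite inE negbK => /eqP ->; rewrite scale0r.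
    by apply: spanb; apply: msize_prod_le.
  rewrite card_ffun !card_ord cardT => /leq_trans -> //.
  apply: (@leq_trans (\sum_(i < e.+1) C * e.+1 ^ D)).
    apply: leq_sum => i _; apply: leq_trans (bndC i) _.
    by rewrite leq_mul2l leq_expn ?orbT.
  by rewrite sum_nat_const card_ord expnS mulnCA.
rewrite leqNgt; apply/negP => lt_Dd.
(* If [D.+1 < d], the bound [k ^ d <= M * k ^ D.+1] fails at [k = M.+1]. *)
pose M := (C * (c * d).+1 ^ D.+1)%N.
have bndM k : (0 < k)%N -> (k ^ d <= M * k ^ D.+1)%N.
  move=> k0; apply: leq_trans (count k) _.
  rewrite /M -(mulnA C) leq_mul2l -expnMn leq_expn ?orbT //.
  by rewrite mulSn mulnAC -add1n leq_add2r.
have := bndM M.+1 isT; rewrite leqNgt => /negP; apply.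
apply: (@leq_trans (M.+1 * M.+1 ^ D.+1)).
  by rewrite ltn_mul2r ltnSn expn_gt0.
by rewrite -expnS leq_pexp2l.
Qed.

(** Membership is tested on the chosen representative of a class; as [P] contains [I], any other
    representative gives the same answer. *)
Lemma prime_ideal_of_quotient (N : nat) (I : idealr {mpoly K[N]})
    (P : {mpoly K[N]} -> Prop) :
  is_prime P -> (forall f, f \in I -> P f) ->
  exists p : prime_idealr {ideal_quot I}, forall f, (\pi_{ideal_quot I} f \in p) <-> P f.
Proof.
move=> prP IP; have [P0 P1 PD PM Pprime] := prP.
pose S : pred {ideal_quot I} := fun a => `[< P (repr a) >].
have SE f : (\pi_{ideal_quot I} f \in S) <-> P f.
  have Pr : P (repr (\pi_{ideal_quot I} f) - f).
    by apply: IP; rewrite -quot_pi_eq0 rmorphB /= reprK subrr.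
  split=> [/asboolP Pf|Pf]; last apply/asboolP.
    by rewrite -[f](subKr (repr (\pi_{ideal_quot I} f))); apply: idealB (prime_is_ideal prP) _ _.
  by rewrite -(subrK f (repr _)); apply: PD.
have clS : idealr_closed S.
  split; first by rewrite -(rmorph0 (\pi_{ideal_quot I})); apply/SE.
    by rewrite -(rmorph1 (\pi_{ideal_quot I})); apply/negP => /SE.
  move=> a u v; rewrite -[a]reprK -[u]reprK -[v]reprK => /SE Pu /SE Pv.
  by rewrite -rmorphM -rmorphD; apply/SE; apply: PD => //; apply: PM.
have prS : prime_idealr_closed S.
  move=> u v; rewrite -[u]reprK -[v]reprK -rmorphM => /SE /Pprime [] Puv; apply/orP.
    by left; apply/SE.
  by right; apply/SE.
pose SI := isIdealr.Build _ S clS.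
pose SP := isPrimeIdealrClosed.Build _ S prS.
pose p : prime_idealr {ideal_quot I} := HB.pack S SI SP.
by exists p.
Qed.

End PrimeChains.

(** * A chain of [n + 2] primes containing a binomial edge ideal *)

Section CompletePrimes.
Variables (K : fieldType) (n : nat).
Hypothesis n_gt0 : (0 < n)%N.
Local Notation S := {mpoly K[n + n]}.

Definition all_vertices : 'I_n -> 'I_n := fun=> Ordinal n_gt0.

(* [chain_vars k] consists of [x_i, y_i] for [i < k] when [k < n], of all the
   variables but the last [y] when [k = n], and of all of them when [k > n]. *)
Definition chain_vars (k : nat) : {set 'I_(n + n)} :=
  [set z | match split z with
           | inl i => (i < k)%N
           | inr i => (i < k)%N && ((i.+1 < n)%N || (n < k)%N)
           end].

Lemma chain_vars_x k i : (lshift n i \in chain_vars k) = (i < k)%N.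
Proof. by rewrite inE (unsplitK (inl i)). Qed.

Lemma chain_vars_y k i :
  (rshift n i \in chain_vars k) = (i < k)%N && ((i.+1 < n)%N || (n < k)%N).
Proof. by rewrite inE (unsplitK (inr i)). Qed.

Lemma chain_varsS k k' : (k <= k')%N -> chain_vars k \subset chain_vars k'.
Proof.
move=> le_kk; apply/subsetP => z; case: (splitP z) => i zE.
  rewrite (_ : z = lshift n i); last exact: val_inj.
  by rewrite !chain_vars_x => /leq_trans ->.
rewrite (_ : z = rshift n i); last exact: val_inj.
rewrite !chain_vars_y => /andP [ik /orP h]; rewrite (leq_trans ik) //=.
by apply/orP; case: h => [?|?]; [left | right; apply: leq_trans le_kk].
Qed.

(** Each edge binomial is fixed or killed. If [i < k <= j], then [i.+1 < n] and both variables of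
    [i] vanish; if [i] and [j] are below [k], both [x] variables vanish. *)
Lemma kill_chain_vars k (f : S) :
  edge_ideal (cliques all_vertices) f -> edge_ideal (cliques all_vertices) (kill (chain_vars k) f).
Proof.
set G := cliques _; have idJ := edge_ideal_ideal K G.
apply: (edge_idealP (kill_ideal (chain_vars k) idJ)) => i j Gij.
suff -> : kill (chain_vars k) (edge_binomial K i j) =
    if (i < k)%N || (j < k)%N then 0 else edge_binomial K i j.
  by case: ifP => _; [exact: ideal0 | apply: edge_ideal_gen => //; exact: cliques_sym].
rewrite /edge_binomial raddfB /= !rmorphM /= !killx !killy !chain_vars_x !chain_vars_y.
have ltin := ltn_ord i; have ltjn := ltn_ord j.
have [ik|ki] := ltnP i k; have [jk|kj] := ltnP j k; rewrite /= ?mul0r ?mulr0 ?subrr //.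
  by rewrite (leq_ltn_trans _ (leq_trans ltjn (leqnn _))) ?mulr0 ?subrr // (leq_trans ik).
by rewrite (leq_ltn_trans _ (leq_trans ltin (leqnn _))) ?mulr0 ?subrr // (leq_trans jk).
Qed.

(** The ideal of [K_n] enlarged by the variables in [chain_vars k], written as the kernel of a
    morphism to a domain. *)
Definition chain_prime k (f : S) : Prop := param all_vertices (kill (chain_vars k) f) = 0.

Lemma chain_primeP k : is_prime (chain_prime k).
Proof.
rewrite /chain_prime; split=> [||f g f0 g0|a f f0|f g].
- by rewrite !rmorph0.
- by rewrite !rmorph1 => /eqP; rewrite oner_eq0.
- by rewrite !rmorphD /= f0 g0 addr0.
- by rewrite !rmorphM /= f0 mulr0.
by rewrite !rmorphM /= => /eqP; rewrite mulf_eq0 => /orP [] /eqP; [left | right].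
Qed.

Lemma edge_ideal_chain_prime G k f : graph G -> edge_ideal G f -> chain_prime k f.
Proof.
move=> [_ irrG] Jf; apply: param_cliques; apply: kill_chain_vars.
apply: edge_idealS Jf; first exact: cliques_sym.
by move=> i j Gij; rewrite /cliques /= eqxx andbT; apply: contraTneq Gij => ->; rewrite irrG.
Qed.

Lemma chain_prime_sub k k' f : (k <= k')%N -> chain_prime k f -> chain_prime k' f.
Proof.
move=> /chain_varsS /setUidPl sub /param_ker /(kill_chain_vars k') /param_cliques.
by rewrite killU sub.
Qed.

Lemma chain_prime_strict k k' : (k < k')%N -> (k' <= n.+1)%N ->
  exists f, chain_prime k' f /\ ~ chain_prime k f.
Proof.
move=> lt_kk le_kn; rewrite /chain_prime.
(* The witness is [x_k] if [k < n], and the last [y] if [k = n]. *)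
have [lt_kn|le_nk] := ltnP k n.
  exists (varx K (Ordinal lt_kn)); rewrite !killx !chain_vars_x /= lt_kk ltnn.
  by rewrite raddf0 param_x; split=> //; apply/eqP; rewrite mulf_neq0 ?mpolyX_neq0.
have lt_pn : (n.-1 < n)%N by rewrite prednK.
have lt_nk : (n < k')%N by apply: leq_ltn_trans lt_kk.
have nlt_nk : (n < k)%N = false by apply/negbTE; rewrite -leqNgt -ltnS (leq_trans lt_kk).
exists (vary K (Ordinal lt_pn)); rewrite !killy !chain_vars_y /= prednK //.
rewrite ltnn lt_nk nlt_nk andbF (ltnW lt_nk) raddf0.
by rewrite param_y; split=> //; apply/eqP; rewrite mulf_neq0 ?mpolyX_neq0.
Qed.

Lemma krull_lower_bound (G : rel 'I_n) : graph G ->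
  exists p : 'I_n.+2 -> prime_idealr {ideal_quot (binomial_edge_ideal K G : idealr S)},
  prime_chain p.
Proof.
move=> grG.
have /choice [p pP] : forall k : 'I_n.+2,
    exists p : prime_idealr {ideal_quot (binomial_edge_ideal K G : idealr S)},
    forall f, (\pi_{ideal_quot (binomial_edge_ideal K G : idealr S)} f \in p) <-> chain_prime k f.
  move=> k; apply: prime_ideal_of_quotient; first exact: chain_primeP.
  by move=> f; apply: edge_ideal_chain_prime.
exists p => i j lt_ij; split=> [a|sub].
  by rewrite -[a]reprK => /pP /(chain_prime_sub (ltnW lt_ij)) /pP.
have [|f [Pj]] := chain_prime_strict lt_ij; first by rewrite -ltnS.
by apply; apply/pP; apply: sub; apply/pP.
Qed.

End CompletePrimes.

(** * The structure of lollipop graphs *)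

Lemma path_graph_sym s : ssrbool.symmetric (@path_graph s).
Proof. by move=> u v; rewrite /path_graph /= orbC. Qed.

Lemma path_edge_clique s (u v : 'I_s) : path_graph u v -> is_clique (@path_graph s) [set u; v].
Proof.
move=> uv; apply/forall_inP => i /set2P iuv; apply/forall_inP => j /set2P juv.
by apply/implyP; case: iuv juv => -> [] ->; rewrite ?eqxx // path_graph_sym.
Qed.

(** Each edge at an inner vertex extends to a maximal clique. By uniqueness these coincide, so the
    two neighbours would be adjacent. *)
Lemma path_free_vertex s (u : 'I_s) : free_vertex (@path_graph s) u ->
  u = 0%N :> nat \/ u.+1 = s.
Proof.
case=> A [[maxA uA] uniqA].
have [u0|u0] := eqVneq (u : nat) 0%N; first by left.
have [us|us] := eqVneq u.+1 s; first by right.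
have lt_pred : (u.-1 < s)%N by have := ltn_ord u; lia.
have lt_succ : (u.+1 < s)%N by have := ltn_ord u; lia.
have nbrA v : path_graph u v -> v \in A.
  move=> /path_edge_clique /maxset_exists [B maxB /subsetP sub].
  have -> : A = B by apply: uniqA; split=> //; apply: sub; apply: set21.
  by apply: sub; apply: set22.
have [pA sA] : Ordinal lt_pred \in A /\ Ordinal lt_succ \in A.
  by split; apply: nbrA; rewrite /path_graph /= ?prednK ?eqxx ?orbT // lt0n.
have /forall_inP /(_ _ pA) /forall_inP /(_ _ sA) := maxsetp maxA.
rewrite /path_graph -val_eqE /=; have := ltn_ord u.
move=> _ /implyP h; exfalso; have /h : (u.-1 != u.+1)%N by lia.
by move=> /orP [] /eqP; lia.
Qed.

(** The conditional is the step toward [w]: across an edge, if [t] is not the step from [s], then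
    [s] is the step from [t]. *)
Lemma path_step_arith (w s t : nat) :
  (s != w)%N -> (s.+1 == t) || (t.+1 == s) ->
  (t != (if (s < w)%N then s.+1 else s.-1)) ->
  t != w /\ s = (if (t < w)%N then t.+1 else t.-1).
Proof. by case: (ltnP s w) => ?; case: (ltnP t w) => ?; lia. Qed.

(** As [w] is an end of the path, all other vertices lie on one side of it; at an inner [w] the
    steps from both sides would meet. *)
Lemma path_end_arith (w e s t : nat) : w = 0%N \/ w.+1 = e -> (s < e)%N -> (t < e)%N ->
  s != w -> t != w ->
  (if (s < w)%N then s.+1 else s.-1) = (if (t < w)%N then t.+1 else t.-1) -> s = t.
Proof. by case: (ltnP s w) => ?; case: (ltnP t w) => ?; lia. Qed.

Section LollipopStructure.
Variables (m k : nat) (r : 'I_k -> nat) (n : nat) (G : rel 'I_n).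
Variables (a : 'I_k -> 'I_m) (w : forall i, 'I_(r i)) (pr : pieces m r -> 'I_n).
Local Notation V := {i : 'I_k & 'I_(r i)}.
Hypotheses (a_inj : injective a)
  (w_free : forall i, free_vertex (@path_graph (r i)) (w i))
  (pr_surj : forall v, exists z, pr z = v)
  (prP : forall z z', pr z = pr z' <-> glue a w z = glue a w z')
  (adjP : forall u v, G u v <->
    exists z z', [/\ pr z = u, pr z' = v & pieces_adj z z']).

Definition attached (s : V) : bool := tagged s == w (tag s).

Lemma glue_inr s : glue a w (inr s) = if attached s then inl (a (tag s)) else inr s.
Proof. by case: s. Qed.

Lemma glue_id z : glue a w (glue a w z) = glue a w z.
Proof. by case: z => // s; rewrite glue_inr; case: ifP => // sw; rewrite glue_inr sw. Qed.

Lemma pr_glue z : pr (glue a w z) = pr z.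
Proof. by apply/prP; rewrite glue_id. Qed.

(** Applying [glue] makes the representative canonical: an attaching vertex is always represented in
    [K_m]. *)
Definition normal_piece v : pieces m r := glue a w (projT1 (cid (pr_surj v))).

Lemma pr_normal_piece v : pr (normal_piece v) = v.
Proof. by rewrite pr_glue; case: (cid _). Qed.

Lemma glue_normal_piece v : glue a w (normal_piece v) = normal_piece v.
Proof. exact: glue_id. Qed.

Lemma normal_piece_pr z : normal_piece (pr z) = glue a w z.
Proof. by rewrite -glue_normal_piece; apply/prP; apply: pr_normal_piece. Qed.

(** The fixed points of [glue] are in bijection with the vertices of [G], and the other pieces are
    the [k] end vertices [w i]. *)
Lemma glue_card : (n + k = m + \sum_(i < k) r i)%N.
Proof.
pose F := [set z | glue a w z == z].
have cardF : #|F| = n.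
  rewrite -[RHS]card_ord -cardsT -(_ : pr @: F = setT).
    rewrite card_in_imset // => z z'; rewrite !inE => /eqP zF /eqP zF' /prP.
    by rewrite zF zF'.
  apply/setP => v; rewrite inE; apply/imsetP; exists (normal_piece v).
    by rewrite inE glue_normal_piece.
  by rewrite pr_normal_piece.
have cardFc : #|~: F| = k.
  pose h i : pieces m r := inr (existT _ i (w i)).
  rewrite -[RHS]card_ord -cardsT -(_ : h @: setT = ~: F).
    by rewrite card_imset // => i j [].
  apply/setP => z; rewrite !inE; apply/imsetP/idP => [[i _ ->]|].
    by rewrite /h glue_inr /attached /= eqxx.
  case: z => [x|s]; first by rewrite /= eqxx.
  rewrite glue_inr /attached; case: s => i j /=; case: (j =P w i) => [->|]; last by rewrite eqxx.
  by exists i.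
have := cardsC F; rewrite cardF cardFc => ->.
rewrite card_sum card_ord card_tagged sumnE big_map big_enum.
by congr (_ + _)%N; apply: eq_bigr => i _; rewrite card_ord.
Qed.

Definition clique_part : {set 'I_n} := [set v | if normal_piece v is inl _ then true else false].

Lemma clique_partP v : reflect (exists x, normal_piece v = inl x) (v \in clique_part).
Proof.
by rewrite inE; case: (normal_piece v) => z; apply: (iffP idP) => //; [exists z | case].
Qed.

Lemma handle_partP v : v \notin clique_part ->
  exists2 s : V, normal_piece v = inr s & ~~ attached s.
Proof.
rewrite inE; case vE: (normal_piece v) => [//|s] _; exists s => //.
apply/negP => sw; have := glue_normal_piece v.
by rewrite vE glue_inr sw.
Qed.

Lemma card_clique_part : #|clique_part| = m.
Proof.
rewrite -[RHS]card_ord -cardsT -(_ : (fun x => pr (inl x)) @: setT = clique_part).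
  by rewrite card_imset // => x y /prP [].
apply/setP => v; apply/imsetP/clique_partP => [[x _ ->]|[x vx]].
  by exists x; rewrite normal_piece_pr.
by exists x; rewrite // -vx pr_normal_piece.
Qed.

(** The neighbour of [s] on the side of the attaching vertex, meaningful when [s] is not attached.
    The default of [insubd] is never taken, by [val_toward]. *)
Definition toward (s : V) : V :=
  Tagged (fun i => 'I_(r i))
    (insubd (tagged s) (if (tagged s < w (tag s))%N then (tagged s).+1 else (tagged s).-1)).

(** An absolute difference: one of the two truncated subtractions is zero. *)
Definition distance (s : V) : nat := ((tagged s - w (tag s)) + (w (tag s) - tagged s))%N.

Lemma val_toward s : tagged (toward s) =
  (if (tagged s < w (tag s))%N then (tagged s).+1 else (tagged s).-1) :> nat.
Proof.
have lt_r : ((if (tagged s < w (tag s))%N then (tagged s).+1 else (tagged s).-1) < r (tag s))%N.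
  have w_r := ltn_ord (w (tag s)); have s_r := ltn_ord (tagged s).
  case: ifP => [sw|_]; [exact: (leq_ltn_trans sw w_r) | apply: leq_ltn_trans (leq_pred _) s_r].
by rewrite val_insubd lt_r.
Qed.

Lemma attachedE s : attached s = (tagged s == w (tag s) :> nat).
Proof. by []. Qed.

Lemma pieces_adj_inr s t : pieces_adj (inr s : pieces m r) (inr t) =
  (tag s == tag t) && (((tagged s).+1 == tagged t :> nat) || ((tagged t).+1 == tagged s :> nat)).
Proof.
case: s t => i j [i' j'] /=; case: eqP => //= ii'; case: _ / ii' j' => j'.
by rewrite tagged_asE.
Qed.

Lemma eq_path_vertex (s t : V) : tag s = tag t -> tagged s = tagged t :> nat -> s = t.
Proof.
case: s t => i j [i' j'] /= ii'; case: _ / ii' j' => j' jj'.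
by congr existT; apply: val_inj.
Qed.

Lemma pieces_adj_sym : ssrbool.symmetric (@pieces_adj m k r).
Proof.
case=> [x|s] [y|t] //; first by rewrite /= /complete_graph /= eq_sym.
by rewrite !pieces_adj_inr (eq_sym (tag s)) orbC.
Qed.

Lemma w_end i : w i = 0%N :> nat \/ (w i).+1 = r i.
Proof. exact: path_free_vertex. Qed.

Lemma towardP s : ~~ attached s ->
  pieces_adj (inr s : pieces m r) (inr (toward s)) /\ (distance (toward s) < distance s)%N.
Proof.
rewrite attachedE => sw; rewrite pieces_adj_inr /distance !val_toward /= eqxx /=.
by have [?|?] := ltnP (tagged s) (w (tag s)); split; lia.
Qed.

Lemma toward_inj s t : ~~ attached s -> ~~ attached t ->
  tag s = tag t -> tagged (toward s) = tagged (toward t) :> nat -> s = t.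
Proof.
rewrite !attachedE !val_toward => sw tw eq_tag.
have eq_w : w (tag s) = w (tag t) :> nat by rewrite eq_tag.
have lt_t : (tagged t < r (tag s))%N by rewrite eq_tag.
rewrite -eq_w in tw *; move=> eq_st; apply: eq_path_vertex => //.
exact: path_end_arith (w_end (tag s)) (ltn_ord _) lt_t sw tw eq_st.
Qed.

Lemma adj_toward s t : ~~ attached s -> pieces_adj (inr s : pieces m r) (inr t) ->
  t = toward s \/ ~~ attached t /\ s = toward t.
Proof.
rewrite !attachedE pieces_adj_inr => sw /andP [/eqP eq_tag adj].
have eq_w : w (tag s) = w (tag t) :> nat by rewrite eq_tag.
have [ts|ts] := eqVneq (tagged t : nat) (tagged (toward s)).
  by left; apply: eq_path_vertex; rewrite // eq_tag.
right; move: ts; rewrite val_toward => ts; have [tw sE] := path_step_arith sw adj ts.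
split; first by rewrite -eq_w.
by apply: eq_path_vertex; rewrite // val_toward -eq_w.
Qed.

Definition parent v : 'I_n :=
  if normal_piece v is inr s then pr (inr (toward s)) else v.

Definition height v : nat := if normal_piece v is inr s then distance s else 0%N.

(** Gluing creates no loop: adjacent pieces lie both in [K_m] or both in one path, and [glue] is
    injective on each of these. *)
Lemma lollipop_graph : graph G.
Proof.
have symG u v : G u v -> G v u.
  move=> /adjP [z [z' [zu zv adj]]]; apply/adjP; exists z', z.
  by rewrite pieces_adj_sym.
split=> [u v|u]; first by apply/idP/idP; apply: symG.
apply/negP => /adjP [z [z' [<- /esym /prP]]].
case: z z' => [x|s] [y|t] //=; first by case=> ->; rewrite /complete_graph /= eqxx.
rewrite -/(glue a w (inr s)) -/(glue a w (inr t)) !glue_inr.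
rewrite -[_ && _]/(pieces_adj (inr s : pieces m r) (inr t)) pieces_adj_inr.
case: ifP => sw; case: ifP => tw // [].
  move=> _ /andP [/eqP eq_tag]; move: sw tw; rewrite !attachedE => /eqP -> /eqP ->.
  by rewrite eq_tag orbb eqn_leq ltnn.
by move=> ->; rewrite eqxx orbb eqn_leq ltnn.
Qed.

Lemma clique_part_complete i j : i \in clique_part -> j \in clique_part -> G i j = (i != j).
Proof.
move=> /clique_partP [x ix] /clique_partP [y jy].
apply/idP/idP => [Gij|].
  by apply: contraTneq Gij => ->; case: lollipop_graph => _ ->.
rewrite -(pr_normal_piece i) -(pr_normal_piece j) ix jy => ij.
apply/adjP; exists (inl x), (inl y); split=> //=.
by rewrite /complete_graph /=; apply: contraNneq ij => ->.
Qed.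

(** Only one piece lies over a handle vertex, so its edges all come from a single path, where
    [adj_toward] applies. *)
Lemma handle_part_adj i j : i \notin clique_part ->
  G i j = (parent i == j) || (j \notin clique_part) && (parent j == i).
Proof.
have adj_parent v : v \notin clique_part -> G v (parent v).
  move=> /handle_partP [s vs sw]; apply/adjP; exists (inr s), (inr (toward s)).
  by split; [rewrite -vs pr_normal_piece | rewrite /parent vs | case: (towardP sw)].
move=> iC; apply/idP/orP => [/adjP [z [z' [zi zj adj]]]|]; last first.
  case=> [/eqP <-|/andP [jC /eqP <-]]; first exact: adj_parent.
  by case: lollipop_graph => -> _; apply: adj_parent.
have [s iS sw] := handle_partP iC.
have zE : z = inr s.
  move: (normal_piece_pr z); rewrite zi iS; case: (z) => // s'.
  by rewrite glue_inr; case: ifP => // _ [->].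
move: zE zj adj => -> {z zi}; case: z' => // t tj /(adj_toward sw) [tE|[tw sE]].
  by left; rewrite /parent iS -tE tj.
right; have jt : normal_piece j = inr t by rewrite -tj normal_piece_pr glue_inr (negPf tw).
by rewrite inE jt /parent jt -sE -iS pr_normal_piece eqxx.
Qed.

(** If both parents are attaching vertices, injectivity of [a] puts [i] and [j] on the same handle;
    along one handle [toward_inj] concludes. *)
Lemma parent_inj i j : i \notin clique_part -> j \notin clique_part ->
  parent i = parent j -> i = j.
Proof.
move=> /handle_partP [s iS sw] /handle_partP [t jt tw].
rewrite /parent iS jt => /prP; rewrite !glue_inr => eq_st.
rewrite -(pr_normal_piece i) -(pr_normal_piece j) iS jt; congr (pr (inr _)).
move: eq_st; case: ifP => ssw; case: ifP => tsw // [].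
  move=> /a_inj /= eq_tag; apply: toward_inj => //.
  by move: ssw tsw; rewrite !attachedE => /eqP -> /eqP ->; rewrite /= eq_tag.
move=> eq_tag eq_toward; apply: toward_inj => //.
by rewrite (eq_toward : toward s = toward t).
Qed.

Lemma height_parent i : i \notin clique_part -> (height (parent i) < height i)%N.
Proof.
move=> /handle_partP [s iS sw]; have [_ lt_s] := towardP sw.
rewrite /height /parent iS normal_piece_pr glue_inr; case: ifP => // _.
exact: leq_ltn_trans lt_s.
Qed.

Lemma hilb_lollipop (K : fieldType) : (0 < m)%N ->
  hilb_numerator (@edge_ideal K n G) ((1 - 'X^2) ^+ (n - m) * complete_numerator m).
Proof.
move=> m0; have := @hilb_handles K n G clique_part parent height lollipop_graph.
rewrite card_clique_part; apply=> //.
- exact: clique_part_complete.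
- exact: handle_part_adj.
- exact: parent_inj.
exact: height_parent.
Qed.

End LollipopStructure.

(** * Hilbert series, dimension and multiplicity of lollipop graphs *)

Theorem proposition3p5 (K : fieldType) (m k : nat) (r : 'I_k -> nat)
    (n : nat) (G : rel 'I_n) :
  (2 <= m)%N ->
  (forall i, (1 <= r i)%N) ->
  is_lollipop m r G ->
  let J : idealr {mpoly K[n + n]} := binomial_edge_ideal K G in
  let rs := (\sum_(i < k) r i)%N in
  [/\ series_eq_frac (hilbert_series J)
        (((m - 1)%:R *: 'X + 1) * (1 + 'X) ^+ (rs - k)) (m + rs - k + 1),
      has_krull_dim {ideal_quot J} (m + rs - k + 1)
    & has_multiplicity J (2 ^+ (rs - k) * m%:R)].
Proof.
move=> m2 _ [a [w [pr [a_inj w_free pr_surj prP adjP]]]] J rs.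
have m0 : (0 < m)%N by apply: leq_trans m2.
have cardV := glue_card pr_surj prP.
have le_mn : (m <= n)%N.
  by rewrite -(card_clique_part pr_surj prP) -[X in (_ <= X)%N]card_ord max_card.
(* By [glue_card], the number [l] of vertices outside the clique is [rs - k]. *)
have [l nE] : exists l, n = (m + l)%N by exists (n - m)%N; rewrite subnKC.
have [-> ->] : (rs - k = l)%N /\ (m + rs - k + 1 = n.+1)%N by lia.
have series : series_eq_frac (hilbert_series J)
    (((m - 1)%:R *: 'X + 1) * (1 + 'X) ^+ l) n.+1.
  apply: (@poly_series_frac K (n + n)) => [d|].
    rewrite hilbert_seriesE.
    exact: (hilb_lollipop a_inj w_free pr_surj prP adjP K m0 d).
  have -> : (n - m = l)%N by lia.
  rewrite /complete_numerator.
  have -> : (1 - 'X^2) = (1 - 'X) * (1 + 'X) :> {poly int} by ring.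
  rewrite exprMn -mul_polyC rmorph_nat subn1.
  (* The powers of [1 - 'X] come from the denominator, from the [l] factors [1 - 'X^2] and from the
     clique. *)
  have -> : (n + n = n.+1 + l + m.-1)%N by lia.
  rewrite !exprD; ring.
have n0 : (0 < n)%N by apply: leq_trans le_mn.
have krull : has_krull_dim {ideal_quot J} n.+1.
  split; first by apply: (krull_lower_bound K n0 (lollipop_graph prP adjP)).
  exact: krull_upper_bound series.
split=> //; exists n.+1, (((m - 1)%:R *: 'X + 1) * (1 + 'X) ^+ l); split=> //.
rewrite hornerM horner_exp !hornerD hornerZ hornerX hornerC mulr1.
rewrite mulrC; congr (_ * _).
by rewrite natr1 subn1 prednK.
Qed.
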